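(* Let $\mathcal{W}(F)$ be an implicit $d$-web of the plane with presentation polynomial $P_F(z;x,y)=a_0(x,y)z^d+\cdots+a_d(x,y)$, and let $\Delta$ be the $z$-discriminant of $P_F$. The Lie algebra of symmetries of the web $\mathcal{W}(F)$ is a Lie subalgebra of $\mathrm{Der}(\Delta)$.
   Context: Let $F(x,y,y')=a_0(x,y)(y')^d+a_1(x,y)(y')^{d-1}+\cdots+a_d(x,y)=0$, $y'=dy/dx$, be a first-order differential equation, polynomial of degree $d$ in $y'$, with coefficients $a_i\in\mathbb{C}\{x,y\}$, the ring of analytic functions in $x,y$. Its presentation polynomial is $P_F(z;x,y)=a_0(x,y)z^d+\cdots+a_d(x,y)$. Let $R_{P_F}$ be the resultant in $z$ of $P_F$ and $\partial_zP_F$. One works throughout outside the singular locus, i.e. under the condition $R_{P_F}\neq 0$; then $P_F$ has $d$ distinct roots $p_1(x,y),\dots,p_d(x,y)$ in $z$. The implicit $d$-web $\mathcal{W}(F)$ is the family of the $d$ foliations of the plane, in general position, given by the equations $y'=p_i(x,y)$, $i=1,\dots,d$. The $z$-discriminant of $P_F$ is $\Delta=a_0^{2d-2}\prod_{1\le i<j\le d}(p_i-p_j)^2$, and $R_{P_F}=(-1)^{d(d-1)/2}a_0\Delta$. The Lie algebra of symmetries of $\mathcal{W}(F)$ is the set, with the bracket of vector fields, of the infinitesimal generators $X=\alpha_1\partial_x+\alpha_2\partial_y$ ($\alpha_1,\alpha_2$ analytic functions of $(x,y)$) of local Lie groups of transformations leaving the web globally invariant, i.e. of symmetry groups of each equation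 $y'=p_i(x,y)$; equivalently, for each $i=1,\dots,d$, $$-\alpha_1\partial_x(p_i)-\alpha_2\partial_y(p_i)+\partial_x(\alpha_2)+(\partial_y(\alpha_2)-\partial_x(\alpha_1))p_i-\partial_y(\alpha_1)p_i^2=0.$$ For an algebraic curve $\mathscr{C}$ defined by a polynomial $g$, the module of derivations $\mathrm{Der}(\mathscr{C})$ is the Lie algebra of logarithmic vector fields, i.e. of the vector fields $X$ for which there exists a cofactor $K$ with $X(g)=Kg$ ($g$ is then called a Darboux polynomial of $X$). $\mathrm{Der}(\Delta)$ denotes the same object for the discriminant curve $\{\Delta=0\}$: the vector fields $X$ (with analytic coefficients) for which there is an analytic cofactor $K$ with $X(\Delta)=K\Delta$.
   Formalization: Symmetries and Der(Δ) are taken away from the points where all a_i vanish (all inside R=0). Across a curve of such points the claim fails: for x(y'^2-1)=0, ∂_x is a symmetry, Δ=4x^2 and ∂_xΔ=(2/x)Δ. Across isolated such points K extends by Hartogs. *)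

(* Defs.v *)
From HB Require Import structures.
From mathcomp Require Import all_boot all_order all_algebra complex.
From mathcomp Require Import all_classical all_reals topology normedtype.
From mathcomp Require Import sequences derive.
Set Implicit Arguments.
Unset Strict Implicit.
Unset Printing Implicit Defensive.
Import Order.TTheory GRing.Theory Num.Theory.
Import numFieldNormedType.Exports.
Local Open Scope classical_set_scope.
Local Open Scope ring_scope.

(* R[i], packed so that it carries the topology that MathComp-Analysis puts on
   every numFieldType. *)
Definition Cplx (R : realType) : numClosedFieldType := R[i]%C.

(* The functions on the plane, with pointwise operations. *)
Definition planeFun (R : realType) : comNzRingType :=
  (Cplx R * Cplx R)%type -> Cplx R.

Section Plane.
Variable R : realType.
Local Notation C := (Cplx R).

(* f is, near u = (x, y), the sum of an absolutely convergent power series in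
   the two variables h, k: f (x + h, y + k) = sum_(i, j) c_ij h^i k^j.  The
   order of C is partial, so 0 < r and the upper bound M make r and M real. *)
Definition analytic_at (f : C * C -> C) (u : C * C) : Prop :=
  exists (c : nat -> nat -> C) (r M : C),
    [/\ 0 < r,
        forall n : nat,
          \sum_(i < n) \sum_(j < n) `|c i j| * r ^+ i * r ^+ j <= M &
        forall h k : C, `|h| < r -> `|k| < r ->
          (fun n : nat => \sum_(i < n) \sum_(j < n) c i j * h ^+ i * k ^+ j)
            @ \oo --> f (u.1 + h, u.2 + k)].

(* Functions are total on C * C, but only their values on U matter. *)
Definition analytic_on (U : set (C * C)) (f : C * C -> C) : Prop :=
  forall u, U u -> analytic_at f u.

Definition dx (f : C * C -> C) (u : C * C) : C := 'D_((1, 0) : C * C) f u.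
Definition dy (f : C * C -> C) (u : C * C) : C := 'D_((0, 1) : C * C) f u.

(* The pair (alpha1, alpha2) stands for alpha1 * dx + alpha2 * dy. *)
Definition vfield : Type := ((C * C -> C) * (C * C -> C))%type.

Definition vf_analytic_on (U : set (C * C)) (X : vfield) : Prop :=
  analytic_on U X.1 /\ analytic_on U X.2.

Definition vf_apply (X : vfield) (f : C * C -> C) (u : C * C) : C :=
  X.1 u * dx f u + X.2 u * dy f u.

Definition vf_bracket (X Y : vfield) : vfield :=
  (fun u => vf_apply X Y.1 u - vf_apply Y X.1 u,
   fun u => vf_apply X Y.2 u - vf_apply Y X.2 u).

Definition vf_lincomb (c : C) (X Y : vfield) : vfield :=
  (fun u => c * X.1 u + Y.1 u, fun u => c * X.2 u + Y.2 u).

Definition lie_algebra (S : set vfield) : Prop :=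
  [/\ S (fun=> 0, fun=> 0),
      forall (c : C) X Y, S X -> S Y -> S (vf_lincomb c X Y) &
      forall X Y, S X -> S Y -> S (vf_bracket X Y)].

Definition lie_subalgebra (S T : set vfield) : Prop :=
  [/\ lie_algebra S, lie_algebra T & S `<=` T].

(* Logarithmic vector fields of {g = 0} on U. *)
Definition Der (U : set (C * C)) (g : C * C -> C) : set vfield :=
  [set X | vf_analytic_on U X /\
     exists2 K : C * C -> C, analytic_on U K &
       forall u, U u -> vf_apply X g u = K u * g u].

Section Web.
Variable d : nat.
Variable a : 'I_d.+1 -> C * C -> C.

(* P_F = a_0 z^d + ... + a_d, over the ring of functions on the plane. *)
Definition presentation : {poly planeFun R} :=
  \sum_(i < d.+1) (a i : planeFun R)%:P * 'X^(d - i).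

(* The value at u of the resultant of P_F and its z-derivative.  The Sylvester
   matrix is formed over the ring of functions, hence in the formal degrees d
   and d - 1 even at the points where a_0 vanishes. *)
Definition presentation_resultant (u : C * C) : C :=
  (resultant presentation presentation^`()%R : planeFun R) u.

Definition presentation_at (u : C * C) : {poly C} :=
  map_poly (fun f : planeFun R => f u) presentation.

(* The product formula defines Delta where a_0 does not vanish; analyticity
   fixes its values at the remaining points of U. *)
Definition is_discriminant (U : set (C * C)) (Delta : C * C -> C) : Prop :=
  analytic_on U Delta /\
  forall u, U u -> a ord0 u != 0 ->
    forall p : 'I_d -> C,
      presentation_at u = (a ord0 u)%:P * \prod_(i < d) ('X - (p i)%:P) ->
      Delta u = a ord0 u ^+ (2 * d - 2) *
                \prod_(i < d) \prod_(j < d | (i < j)%N) (p i - p j) ^+ 2.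

(* p is one of the slopes p_1, ..., p_d of the web on W, outside the singular
   locus. *)
Definition web_slope (W : set (C * C)) (p : C * C -> C) : Prop :=
  [/\ open W,
      forall u, W u -> presentation_resultant u != 0,
      analytic_on W p &
      forall u, W u -> root (presentation_at u) (p u)].

(* X is a symmetry of each equation y' = p (x, y): the first prolongation
   of X is tangent to the surface y' = p. *)
Definition symmetries (U : set (C * C)) : set vfield :=
  [set X | vf_analytic_on U X /\
     forall (W : set (C * C)) (p : C * C -> C), W `<=` U -> web_slope W p ->
       forall u, W u ->
         - X.1 u * dx p u - X.2 u * dy p u + dx X.2 u
         + (dy X.2 u - dx X.1 u) * p u - dy X.1 u * p u ^+ 2 = 0].

(* The points of U where P_F is not the zero polynomial in z.  No analytic
   cofactor need exist at the other points: dx is a symmetry of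
   x * (y' ^ 2 - 1) = 0, with Delta = 4 * x ^ 2 and dx Delta = (2 / x) Delta. *)
Definition equation_domain (U : set (C * C)) : set (C * C) :=
  [set u | U u /\ exists i, a i u != 0].

End Web.
End Plane.

(* Main.v *)
Require Import Defs.
From HB Require Import structures.
From mathcomp Require Import all_boot all_order all_algebra complex.
From mathcomp Require Import all_classical all_reals topology normedtype.
From mathcomp Require Import sequences derive.
From mathcomp Require Import perm separable ring.
Import Order.TTheory GRing.Theory Num.Theory.
Import numFieldNormedType.Exports.
Local Open Scope classical_set_scope.
Local Open Scope ring_scope.
Set Implicit Arguments.
Unset Strict Implicit.
Unset Printing Implicit Defensive.

(** Let X be a symmetry of the web. Along X each slope p_i evolves by
    X p_i = b0 + b1 p_i + b2 p_i^2, where b0 = dx X_2, b1 = dy X_2 - dx X_1 and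
    b2 = - dy X_1 do not depend on i. Hence p_i - p_j is a Darboux germ with
    cofactor b1 + b2 (p_i + p_j), and the product formula for Delta gives, outside
    the singular locus, X Delta = K Delta with
    K = (2 d - 2) mu + d (d - 1) b1 and mu = X a_0 / a_0 + b2 (p_1 + ... + p_d).

    The difficulty is the analyticity of K where a_0 or Delta vanishes. Since the
    roots of P_F move along b0 + b1 z + b2 z^2, the prolonged field sends P_F to a
    multiple of itself:
      X (P_F (z)) + (b0 + b1 z + b2 z^2) P_F' (z) - d (b1 + b2 z) P_F (z) = mu P_F (z).
    The left-hand side is analytic, so mu is the quotient of two analytic functions
    for each value of z. The regular points are dense, so two such quotients agree
    wherever both are defined, and mu extends analytically to every point where
    P_F is not the zero polynomial ([regular_cofactor], [symmetries_sub_Der]).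

    Both sets of fields are Lie algebras because a bracket acts as a commutator
    ([vf_apply_bracket]): in Der (Delta) the bracket has the cofactor X L - Y K,
    and the prolongation b0 + b1 z + b2 z^2 is compatible with brackets
    ([prolongation_bracket]).

    Symmetry is a condition on analytic slopes only, so it has content only if
    such slopes exist. The analytic implicit function theorem supplies them at
    the simple roots ([analytic_root], [local_slopes]): Newton's map is iterated on
    power series, where the coefficients become stationary degree by degree while
    a weighted l1 norm stays bounded ([analytic_fixpoint]). The calculus of analytic
    functions is obtained from coefficients as well: products are Cauchy products
    ([expansionM]), and the derivatives near the centre come from the recentered
    series ([expansion_recentered], [expansion_dx_series]). The passages to the limit
    rest on dominated convergence for double series ([dominated_square_sum]). *)

(** * Convergence of complex sequences *)

Section ComplexSequences.
Variable R : realType.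
Local Notation C := (Cplx R).
Implicit Types (T z : nat -> C) (M e : C).

Let re (x : C) : R := complex.Re (x : R[i]%C).

Let reB (x y : C) : re (x - y) = re x - re y.
Proof. by case: x y => [a b] [c d]. Qed.

Let re_ge0 (x : C) : 0 <= x -> 0 <= re x.
Proof. by case: x => [a b]; rewrite lecE => /andP[]. Qed.

Let re_gt0 (x : C) : 0 < x -> 0 < re x.
Proof. by case: x => [a b]; rewrite ltcE => /andP[]. Qed.

Let reK (x : C) : x \is Num.real -> ((re x)%:C)%C = x.
Proof. exact: RRe_real. Qed.

Let ler_re (x y : C) : x <= y -> re x <= re y.
Proof. by rewrite -subr_ge0 => /re_ge0; rewrite reB subr_ge0. Qed.

Let re_norm (x : C) : `|re x| <= re `|x|.
Proof.
by have := normc_ge_Re x; rewrite lecE => /andP[_] /=.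
Qed.

Let im_norm (x : C) : `|complex.Im (x : R[i]%C)| <= re `|x|.
Proof.
rewrite normc_def /re /= -[leLHS]sqrtr_sqr ler_wsqrtr//.
by rewrite lerDr sqr_ge0.
Qed.

Lemma bounded_monotone_cauchy T M :
    (forall n, 0 <= T n) -> {homo T : m n / (m <= n)%N >-> m <= n} ->
    (forall n, T n <= M) ->
  forall e, 0 < e -> exists K, forall n, (K <= n)%N -> T n - T K < e.
Proof.
move=> T0 Tmono TM e e0.
pose t n := re (T n).
have tmono : {homo t : m n / (m <= n)%N >-> m <= n}.
  by move=> m n mn; apply/ler_re/Tmono.
have tub : has_ubound (range t).
  by exists (re M) => _ [n _ <-]; apply/ler_re/TM.
have tcvg : cvgn t by exact: nondecreasing_is_cvgn.
have [K _ tK] : \forall n \near \oo, `|limn t - t n| < re e.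
  by move/cvgrPdist_lt: tcvg; apply; exact: re_gt0.
exists K => n Kn.
have TE m : T m = ((t m)%:C)%C by rewrite reK// ger0_real.
have -> : e = ((re e)%:C)%C by rewrite reK// gtr0_real.
rewrite !TE -rmorphB ltcR.
apply: le_lt_trans (tK K (leqnn K)).
rewrite ger0_norm; last first.
  by rewrite subr_ge0 nondecreasing_cvgn_le.
by rewrite lerB// nondecreasing_cvgn_le.
Qed.

Let cvg_real_part (z : nat -> C) (f : R[i]%C -> R) T M :
    (forall x y : C, f (x - y) = f x - f y) ->
    (forall x : C, `|f x| <= re `|x|) ->
    (forall n, T n <= M) ->
    (forall m n, (m <= n)%N -> `|z n - z m| <= T n - T m) ->
  cvgn (fun n => f (z n)).
Proof.
move=> fB fnorm TM zT.
have key m n : (m <= n)%N -> `|f (z n) - f (z m)| <= re (T n) - re (T m).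
  move=> mn; rewrite -fB -reB; apply: le_trans (fnorm _) _.
  exact/ler_re/zT.
have Tcvg : cvgn (fun n => re (T n)).
  apply: nondecreasing_is_cvgn.
    move=> m n mn; rewrite -subr_ge0; exact: le_trans (key m n mn).
  by exists (re M) => _ [n _ <-]; apply/ler_re/TM.
have fTcvg : cvgn (fun n => f (z n) + re (T n)).
  apply: nondecreasing_is_cvgn.
    move=> m n mn; rewrite -subr_ge0.
    have := key m n mn; rewrite ler_norml => /andP[+ _].
    by rewrite -subr_ge0 opprK opprD addrACA.
  exists (f (z 0) - re (T 0) + re M + re M) => _ [n _ <-].
  rewrite lerD//; last exact/ler_re/TM.
  have := key 0 n isT; rewrite ler_norml => /andP[_].
  rewrite lerBlDl => /le_trans; apply.
  rewrite -[leRHS]addrA lerD2l [leLHS]addrC lerD2l; exact/ler_re/TM.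
have -> : (fun n => f (z n)) =
          (fun n => (f (z n) + re (T n)) - re (T n)).
  by apply/funext => n; rewrite addrK.
exact: is_cvgB.
Qed.

Let normC_real (x : R) : `|(x%:C)%C : C| = (`|x|%:C)%C.
Proof. by rewrite normc_def /= expr0n addr0 sqrtr_sqr. Qed.

(** The real and the imaginary part each become monotone after adding the
    bounded sequence [T], so completeness of the reals is used only through
    the convergence of bounded monotone sequences. *)
Lemma dominated_increments_cvg z T M :
    (forall n, T n <= M) ->
    (forall m n, (m <= n)%N -> `|z n - z m| <= T n - T m) ->
  exists l : C, z @ \oo --> l.
Proof.
move=> TM zT.
have imB (x y : C) :
    complex.Im (x - y : R[i]%C) = complex.Im (x : R[i]%C) - complex.Im (y : R[i]%C).
  by case: x y => [a b] [c d].
have rcvg := cvg_real_part reB re_norm TM zT.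
have icvg := cvg_real_part imB im_norm TM zT.
set a := limn _ in rcvg; set b := limn _ in icvg.
exists ((a +i* b)%C : R[i]%C); apply/cvgrPdist_lt => e e0.
have e20 : 0 < re (e / 2) by rewrite re_gt0// divr_gt0.
near=> n.
have eE : e / 2 = ((re (e / 2))%:C)%C by rewrite reK// gtr0_real// divr_gt0.
have ra : `|a - re (z n)| < re (e / 2).
  by near: n; by move/cvgrPdist_lt: rcvg; apply.
have ib : `|b - complex.Im (z n : R[i]%C)| < re (e / 2).
  by near: n; by move/cvgrPdist_lt: icvg; apply.
have -> : ((a +i* b)%C : C) - z n =
    (((a - re (z n))%:C)%C : C) + 'i%C * ((b - complex.Im (z n : R[i]%C))%:C)%C.
  case: (z n) => x y; apply/eqP; rewrite eq_complex /re /=.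
  by rewrite !(mul0r, mul1r, mulr0, subr0, addr0, add0r) !eqxx.
rewrite [e]splitr; apply: le_lt_trans (ler_normD _ _) _.
apply: ltrD; rewrite ?normrM eE.
  by rewrite normC_real ltcR.
have -> : `|'i%C : R[i]%C| = 1.
  by rewrite normc_def /= expr0n /= expr1n add0r sqrtr1.
by rewrite mul1r normC_real ltcR.
Unshelve. all: by end_near.
Qed.

End ComplexSequences.

(** * Double series summed over squares *)

Section DoubleSums.
Variable R : realType.
Local Notation C := (Cplx R).
Implicit Types (t w : nat -> nat -> C) (m n : nat).

Definition square_sum t n : C := \sum_(i < n) \sum_(j < n) t i j.

Definition square_part n t i j : C := if (i < n)%N && (j < n)%N then t i j else 0.

Lemma eq_square_sum t t' n :
    (forall i j, (i < n)%N -> (j < n)%N -> t i j = t' i j) ->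
  square_sum t n = square_sum t' n.
Proof.
by move=> tt'; apply: eq_bigr => i _; apply: eq_bigr => j _; exact: tt'.
Qed.

Lemma ler_square_sum t t' n : (forall i j, t i j <= t' i j) ->
  square_sum t n <= square_sum t' n.
Proof. by move=> tt'; apply: ler_sum => i _; apply: ler_sum => j _. Qed.

Lemma square_sum_ge0 t n : (forall i j, 0 <= t i j) -> 0 <= square_sum t n.
Proof. by move=> t0; apply: sumr_ge0 => i _; apply: sumr_ge0 => j _. Qed.

Lemma square_sumD t t' n :
  square_sum (fun i j => t i j + t' i j) n = square_sum t n + square_sum t' n.
Proof.
by rewrite /square_sum -big_split /=; apply: eq_bigr => i _; rewrite -big_split.
Qed.

Lemma square_sumZ (c : C) t n :
  square_sum (fun i j => c * t i j) n = c * square_sum t n.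
Proof. by rewrite /square_sum mulr_sumr; apply: eq_bigr => i _; rewrite mulr_sumr. Qed.

Lemma square_sumB t t' n :
  square_sum (fun i j => t i j - t' i j) n = square_sum t n - square_sum t' n.
Proof.
by rewrite /square_sum -sumrB; apply: eq_bigr => i _; rewrite -sumrB.
Qed.

Lemma square_sum_norm t n :
  `|square_sum t n| <= square_sum (fun i j => `|t i j|) n.
Proof.
apply: le_trans (ler_norm_sum _ _ _) _; apply: ler_sum => i _.
exact: ler_norm_sum.
Qed.

Lemma square_sum_part t m n : (m <= n)%N ->
  square_sum (square_part m t) n = square_sum t m.
Proof.
move=> mn; rewrite /square_sum.
rewrite (big_ord_widen n (fun i => \sum_(j < m) t i j))// [RHS]big_mkcond/=.
apply: eq_bigr => i _; rewrite /square_part; case: ltnP => im; last first.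
  by apply: big1.
by rewrite (big_ord_widen n (fun j => t i j))// [RHS]big_mkcond.
Qed.

Lemma square_sumB_part t m n : (m <= n)%N ->
  square_sum t n - square_sum t m =
  square_sum (fun i j => t i j - square_part m t i j) n.
Proof. by move=> mn; rewrite square_sumB square_sum_part. Qed.

Lemma square_sum_mono t : (forall i j, 0 <= t i j) ->
  {homo square_sum t : m n / (m <= n)%N >-> m <= n}.
Proof.
move=> t0 m n mn; rewrite -subr_ge0 square_sumB_part//.
apply: square_sum_ge0 => i j; rewrite /square_part.
by case: ifP => _; rewrite ?subrr ?subr0.
Qed.

Lemma square_sum_increment t m n : (m <= n)%N ->
  `|square_sum t n - square_sum t m| <=
  square_sum (fun i j => `|t i j|) n - square_sum (fun i j => `|t i j|) m.
Proof.
move=> mn; rewrite !square_sumB_part//; apply: le_trans (square_sum_norm _ _) _.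
apply: ler_square_sum => i j; rewrite /square_part.
by case: ifP => _; rewrite ?subrr ?subr0 ?normr0.
Qed.

Lemma square_sum_cvg t M :
    (forall n, square_sum (fun i j => `|t i j|) n <= M) ->
  exists l : C, square_sum t @ \oo --> l.
Proof.
move=> tM; apply: (dominated_increments_cvg tM) => m n mn.
exact: square_sum_increment.
Qed.

Lemma cvg_square_sum_fixed (s : nat -> nat -> nat -> C) l K :
    (forall i j, (s n i j @[n --> \oo]) --> (l i j : C)) ->
  square_sum (s n) K @[n --> \oo] --> square_sum l K.
Proof.
move=> sl; apply: cvg_big => [|i _]; first exact: add_continuous.
by apply: cvg_big => [|j _]; first exact: add_continuous.
Qed.

(** Dominated convergence for double series (Tannery): outside a fixed large
    square the terms are uniformly negligible, inside it there are only finitely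
    many of them. *)
Lemma dominated_square_sum (s : nat -> nat -> nat -> C) w M (N : nat -> nat) :
    (forall i j, (s n i j @[n --> \oo]) --> (0 : C)) ->
    (forall n i j, `|s n i j| <= w i j) ->
    (forall n, square_sum w n <= M) ->
  square_sum (s n) (N n) @[n --> \oo] --> (0 : C).
Proof.
move=> s0 sw wM; apply/cvgrPdist_lt => e e0.
have w0 i j : 0 <= w i j by exact: le_trans (sw 0 i j).
have e20 : 0 < e / 2 by rewrite divr_gt0.
have [K wK] := bounded_monotone_cauchy (fun n => square_sum_ge0 n w0)
  (square_sum_mono w0) wM e20.
have : square_sum (fun i j => `|s n i j|) K @[n --> \oo] --> square_sum (fun _ _ => 0) K.
  apply: (@cvg_square_sum_fixed (fun n i j => `|s n i j|) (fun _ _ => 0)) => i j.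
  rewrite -[X in _ --> X](@normr0 _ C).
  exact: cvg_norm.
have -> : square_sum (fun _ _ => 0) K = 0.
  by apply: big1 => i _; apply: big1.
move/cvgrPdist_lt/(_ _ e20) => sK.
near=> n; rewrite sub0r normrN.
have : square_sum (fun i j => `|s n i j|) K < e / 2.
  have : `|0 - square_sum (fun i j => `|s n i j|) K| < e / 2 by near: n; exact: sK.
  by rewrite sub0r normrN ger0_norm ?square_sum_ge0.
move=> sKn; apply: le_lt_trans (square_sum_norm _ _) _.
have [NK|/ltnW KN] := leqP (N n) K.
  apply: le_lt_trans (square_sum_mono _ NK) _ => //.
  by apply: lt_trans sKn _; rewrite gtr_pMr// invf_lt1// ltr1n.
rewrite -(subrK (square_sum (fun i j => `|s n i j|) K)
  (square_sum (fun i j => `|s n i j|) (N n))) [e]splitr ltrD//.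
apply: le_lt_trans (wK _ KN); rewrite !square_sumB_part//.
apply: ler_square_sum => i j; rewrite /square_part.
by case: ifP => _; rewrite ?subrr ?subr0.
Unshelve. all: by end_near.
Qed.

End DoubleSums.

(** * Power series in two variables *)

Section PowerSeries.
Variable R : realType.
Local Notation C := (Cplx R).
Implicit Types (c : nat -> nat -> C) (f g : C * C -> C) (u v : C * C) (r h k M : C).

Definition series_term c h k i j : C := c i j * h ^+ i * k ^+ j.

Definition weighted_norm c r i j : C := `|c i j| * r ^+ i * r ^+ j.

(** A bound on the weighted l1 norm, through partial sums so that no limit is
    needed to state it. *)
Definition norm_le c r M := forall n, square_sum (weighted_norm c r) n <= M.

(** Analyticity with the coefficients and the radius made explicit: derivatives
    are read off from the coefficients. *)
Definition expansion c r f u : Prop :=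
  [/\ 0 < r, exists M, norm_le c r M &
      forall h k, `|h| < r -> `|k| < r ->
        square_sum (series_term c h k) @ \oo --> f (u.1 + h, u.2 + k)].

Lemma analytic_atP f u : analytic_at f u <-> exists c r, expansion c r f u.
Proof.
split; last by move=> [c [r [r0 [M cM] cf]]]; exists c, r, M; split.
by move=> [c [r [M [r0 cM cf]]]]; exists c, r; split=> //; exists M.
Qed.

Lemma nbhs_polydisc u (P : set (C * C)) :
  nbhs u P <->
  exists2 r, 0 < r & forall h k, `|h| < r -> `|k| < r -> P (u.1 + h, u.2 + k).
Proof.
split=> [/nbhs_ballP[r /= r0 rP]|[r r0 rP]].
  exists r => // h k hr kr; apply: rP; split; rewrite -ball_normE/=.
    by rewrite opprD addNKr normrN.
  by rewrite opprD addNKr normrN.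
apply/nbhs_ballP; exists r => // -[x y] []; rewrite -!ball_normE/= => xr yr.
have := rP (x - u.1) (y - u.2); rewrite !subrKC; apply; by rewrite distrC.
Qed.

Lemma exists_le_both r r' : 0 < r -> 0 < r' ->
  exists s : C, [/\ 0 < s, s <= r & s <= r'].
Proof.
move=> r0 r'0; case: (real_leP (gtr0_real r0) (gtr0_real r'0)) => [rr'|/ltW r'r].
  by exists r.
by exists r'.
Qed.

(** The order of the complex numbers is partial; nonnegativity passes to the
    limit because it is the closed condition [l = `|l|]. *)
Lemma lim_ge0 (z : nat -> C) (l : C) N : z @ \oo --> l ->
  (forall n, (N <= n)%N -> 0 <= z n) -> 0 <= l.
Proof.
move=> zl z0; have hC := @norm_hausdorff _ C.
suff zn : z @ \oo --> `|l|.
  suff -> : l = `|l| by [].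
  by rewrite -{1}(cvg_lim hC zl) (cvg_lim hC zn).
apply: cvg_trans (cvg_norm zl); apply: near_eq_cvg; near=> n.
by rewrite ger0_norm// z0//; near: n; exact: nbhs_infty_ge.
Unshelve. all: by end_near.
Qed.

Lemma norm_lim_le (z : nat -> C) (l B : C) N : z @ \oo --> l ->
  (forall n, (N <= n)%N -> `|z n| <= B) -> `|l| <= B.
Proof.
move=> zl zB; rewrite -subr_ge0; apply: (@lim_ge0 (fun n => B - `|z n|) _ N) => [|n Nn].
  exact: (cvgB (cvg_cst _) (cvg_norm zl)).
by rewrite subr_ge0 zB.
Qed.

Lemma weighted_norm_ge0 c r i j : 0 <= r -> 0 <= weighted_norm c r i j.
Proof. by move=> r0; rewrite /weighted_norm !mulr_ge0 ?exprn_ge0. Qed.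

Lemma ler_weighted_norm c r s i j : 0 <= r -> r <= s ->
  weighted_norm c r i j <= weighted_norm c s i j.
Proof.
move=> r0 rs; rewrite /weighted_norm.
by rewrite !ler_pM ?mulr_ge0 ?exprn_ge0// lerXn2r// nnegrE (le_trans r0).
Qed.

Lemma norm_series_term c h k i j :
  `|series_term c h k i j| = `|c i j| * `|h| ^+ i * `|k| ^+ j.
Proof. by rewrite !normrM !normrX. Qed.

Lemma norm_series_term_le c h k r i j : `|h| <= r -> `|k| <= r ->
  `|series_term c h k i j| <= weighted_norm c r i j.
Proof.
move=> hr kr; rewrite norm_series_term.
have r0 : 0 <= r by exact: le_trans hr.
by rewrite !ler_pM ?mulr_ge0 ?exprn_ge0// lerXn2r// nnegrE.
Qed.

Lemma series_cvg c h k r M : `|h| <= r -> `|k| <= r ->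
    norm_le c r M ->
  exists l : C, square_sum (series_term c h k) @ \oo --> l.
Proof.
move=> hr kr cM; apply: (@square_sum_cvg _ _ M) => n.
by apply: le_trans (cM n); apply: ler_square_sum => i j; apply: norm_series_term_le.
Qed.

Lemma expansion_shrink c r s f u : 0 < s -> s <= r ->
  expansion c r f u -> expansion c s f u.
Proof.
move=> s0 sr [r0 [M cM] cf]; split; [exact: s0| |].
  exists M => n; apply: le_trans (cM n); apply: ler_square_sum => i j.
  by apply: ler_weighted_norm => //; exact: ltW.
by move=> h k hs ks; apply: cf; [exact: lt_le_trans sr|exact: lt_le_trans sr].
Qed.

Lemma analytic_near_eq f g u :
  (\forall v \near u, f v = g v) -> analytic_at f u -> analytic_at g u.
Proof.
move=> /nbhs_polydisc[s s0 fg] /analytic_atP[c [r cf]].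
have [r0 _ _] := cf.
have [t [t0 tr ts]] := exists_le_both r0 s0.
apply/analytic_atP; exists c, t.
have [_ cM ct] := expansion_shrink t0 tr cf.
split=> [||h k ht kt]; [exact: t0|exact: cM|].
by rewrite -fg ?(lt_le_trans _ ts)//; exact: ct.
Qed.

(** A term of degree at least two gains a factor [t ^+ 2] when the increments are
    at most [t * r]. Continuity and differentiability at the centre both follow. *)
Lemma expansion_taylor1 c r f u : expansion c r f u ->
  exists2 M, 0 <= M & forall t h k, 0 <= t -> t < 1 -> `|h| <= t * r -> `|k| <= t * r ->
    `|f (u.1 + h, u.2 + k) - (c 0 0 + c 1 0 * h + c 0 1 * k)| <= t ^+ 2 * M.
Proof.
move=> [r0 [M cM] cf]; exists M.
  apply: le_trans (cM 0); rewrite square_sum_ge0// => i j.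
  exact/weighted_norm_ge0/ltW.
move=> t h k t0 t1 ht kt.
have tr : t * r < r by rewrite gtr_pMl.
pose c' i j := if (i + j < 2)%N then 0 else c i j.
have cc' n : (2 <= n)%N ->
    square_sum (series_term c h k) n - (c 0 0 + c 1 0 * h + c 0 1 * k) =
    square_sum (series_term c' h k) n.
  move=> n2; apply/eqP; rewrite subr_eq addrC -subr_eq -square_sumB; apply/eqP.
  rewrite (@eq_square_sum _ _ (square_part 2
    (fun i j => series_term c h k i j - series_term c' h k i j))).
    rewrite square_sum_part// /square_sum !(big_ord_recl, big_ord0) /=.
    rewrite /series_term /c' /= /bump /=.
    by rewrite !(expr0, expr1, mulr1, mul0r, subr0, addr0, subrr) addrAC.
  move=> i j _ _; rewrite /square_part; case: ifPn => // ij.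
  rewrite /series_term /c'; case: ifPn => [|_]; last by rewrite subrr.
  by move: ij; case: i j => [|[|i]] [|[|j]].
apply: (norm_lim_le (z := fun n => square_sum (series_term c h k) n -
  (c 0 0 + c 1 0 * h + c 0 1 * k)) (N := 2)) => [|n n2].
  apply: cvgB; last exact: cvg_cst.
  by apply: cf; [exact: le_lt_trans tr|exact: le_lt_trans tr].
rewrite cc'//; apply: le_trans (square_sum_norm _ _) _.
apply: le_trans (_ : t ^+ 2 * square_sum (weighted_norm c r) n <= _).
  rewrite -square_sumZ; apply: ler_square_sum => i j.
  rewrite norm_series_term /c'; case: ltnP => ij.
    by rewrite normr0 !mul0r mulr_ge0 ?exprn_ge0// weighted_norm_ge0// ltW.
  apply: le_trans (_ : `|c i j| * (t * r) ^+ i * (t * r) ^+ j <= _).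
    have tr0 : 0 <= t * r by rewrite mulr_ge0// ltW.
    by rewrite -norm_series_term norm_series_term_le.
  rewrite (_ : _ * _ * _ = t ^+ (i + j) * weighted_norm c r i j); last first.
    by rewrite /weighted_norm !exprMn exprD; ring.
  apply: ler_wpM2r; first by rewrite weighted_norm_ge0// ltW.
  by apply: ler_wiXn2l => //; exact: ltW.
by rewrite ler_wpM2l// exprn_ge0.
Qed.

Lemma expansion_coef00 c r f u : expansion c r f u -> f u = c 0 0.
Proof.
move=> cf; have [r0 _ _] := cf.
have [M M0 /(_ 0 0 0)] := expansion_taylor1 cf.
rewrite lexx ltr01 normr0 mul0r lexx !mulr0 !addr0 expr0n mul0r => /(_ isT isT isT isT).
by case: u cf => x y cf; rewrite normr_le0 subr_eq0 => /eqP.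
Qed.

Lemma expansion_derive (a b : C) c r f u : `|a| <= 1 -> `|b| <= 1 ->
  expansion c r f u -> 'D_((a, b) : C * C) f u = a * c 1 0 + b * c 0 1.
Proof.
move=> a1 b1 cf; have [r0 _ _] := cf.
have [M M0 taylor] := expansion_taylor1 cf.
apply: (@cvg_lim C); first exact: norm_hausdorff.
apply/cvgrPdist_lt => e e0.
(* the remainder is at most `|h| ^+ 2 * M / r ^+ 2, to be compared with `|h| * e *)
pose d := e * r ^+ 2 / (M + 1).
have d0 : 0 < d by rewrite !mulr_gt0 ?exprn_gt0// invr_gt0 ltr_wpDl.
have [s [s0 sr sd]] := exists_le_both r0 d0.
near=> h.
have hs : `|h| < s by near: h; apply: dnbhs0_lt.
have h0 : h != 0 by near: h; exact: nbhs_dnbhs_neq.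
have hr : `|h| < r by exact: lt_le_trans sr.
have hE : (f \o shift u) (h *: ((a, b) : C * C)) = f (u.1 + h * a, u.2 + h * b).
  by rewrite /= /GRing.scale /= addrC.
rewrite hE (expansion_coef00 cf).
have := taylor (`|h| / r) (h * a) (h * b).
rewrite divr_ge0 ?(ltW r0)// ltr_pdivrMr// mul1r divfK ?gt_eqF//.
rewrite !normrM !ler_piMr// => /(_ isT hr isT isT) ineq.
rewrite -(ltr_pM2l (_ : 0 < `|h|)) ?normr_gt0// -normrM.
rewrite distrC /= in ineq *.
have -> : h * (a * c 1 0 + b * c 0 1 - h^-1 *: (f (u.1 + h * a, u.2 + h * b) - c 0 0)) =
    c 0 0 + c 1 0 * (h * a) + c 0 1 * (h * b) - f (u.1 + h * a, u.2 + h * b).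
  by rewrite [_ *: _]/(_ * _) mulrBr mulrA divff// mul1r; ring.
apply: le_lt_trans ineq _.
have -> : (`|h| / r) ^+ 2 * M = `|h| * (`|h| * (M / r ^+ 2)).
  by rewrite exprMn exprVn; ring.
rewrite ltr_pM2l ?normr_gt0//.
apply: le_lt_trans (_ : `|h| * ((M + 1) / r ^+ 2) < _).
  apply: ler_wpM2l => //; apply: ler_wpM2r; last by rewrite lerDl.
  by rewrite invr_ge0 exprn_ge0// ltW.
rewrite -ltr_pdivlMr; first by rewrite invf_div mulrA (lt_le_trans hs).
by rewrite divr_gt0 ?exprn_gt0// ltr_wpDl.
Unshelve. all: by end_near.
Qed.

Lemma expansion_dx c r f u : expansion c r f u -> dx f u = c 1 0.
Proof.
move=> cf; rewrite /dx (expansion_derive _ _ cf) ?normr1 ?normr0//.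
by rewrite mul1r mul0r addr0.
Qed.

Lemma expansion_dy c r f u : expansion c r f u -> dy f u = c 0 1.
Proof.
move=> cf; rewrite /dy (expansion_derive _ _ cf) ?normr1 ?normr0//.
by rewrite mul1r mul0r add0r.
Qed.

Lemma analytic_continuous f u : analytic_at f u -> {for u, continuous f}.
Proof.
move=> /analytic_atP[c [r cf]]; have [r0 _ _] := cf.
have [M M0 taylor] := expansion_taylor1 cf.
apply/cvgrPdist_lt => e e0.
pose B := `|c 1 0| + `|c 0 1| + M / r.
have B0 : 0 <= B by rewrite !addr_ge0// divr_ge0// ltW.
have eB : 0 < e / (B + 1) by rewrite divr_gt0// ltr_wpDl.
have [s [s0 sr sB]] := exists_le_both r0 eB.
pose d := s / 2.
have d0 : 0 < d by rewrite divr_gt0.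
have ds : d < s by rewrite gtr_pMr// invf_lt1// ltr1n.
have dr : d / r < 1 by rewrite ltr_pdivrMr// mul1r (lt_le_trans ds).
have dr0 : 0 <= d / r by rewrite divr_ge0// ltW.
have dB : d * B < e.
  apply: le_lt_trans (_ : d * (B + 1) < _); first by rewrite ler_pM2l// lerDl.
  by rewrite -ltr_pdivlMr ?(lt_le_trans ds)// ltr_wpDl.
apply/nbhs_polydisc; exists d => // h k hd kd.
have := taylor (d / r) h k dr0 dr; rewrite divfK ?gt_eqF//.
move=> /(_ (ltW hd) (ltW kd)) ineq.
rewrite /= (expansion_coef00 cf) distrC; apply: le_lt_trans dB.
rewrite (_ : _ - _ = (f (u.1 + h, u.2 + k) - (c 0 0 + c 1 0 * h + c 0 1 * k)) +
  (c 1 0 * h + c 0 1 * k)); last by ring.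
apply: le_trans (ler_normD _ _) _.
apply: le_trans (lerD ineq (lexx _)) _.
rewrite addrC /B !mulrDr; apply: lerD; last first.
  rewrite (_ : _ ^+ 2 * M = d * (d / r * (M / r))); last by ring.
  by rewrite ler_pM2l// ler_piMl ?(ltW dr)// divr_ge0// ltW.
apply: le_trans (ler_normD _ _) _.
by apply: lerD; rewrite normrM mulrC ler_wpM2r// ltW.
Qed.

End PowerSeries.

(** * Algebra of power series *)

Section PowerSeriesAlgebra.
Variable R : realType.
Local Notation C := (Cplx R).
Implicit Types (c : nat -> nat -> C) (f g : C * C -> C) (u v : C * C) (r h k M : C).

Definition cst_series (a : C) i j : C := if (i == 0)%N && (j == 0)%N then a else 0.

Lemma square_sum_cst (a : C) t n : (0 < n)%N ->
  (forall i j, (0 < i + j)%N -> t i j = 0) -> t 0 0 = a ->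
  square_sum (t : nat -> nat -> C) n = a.
Proof.
move=> n0 t0 ta; rewrite -(square_sum_part (m := n) t (leqnn n)).
rewrite (@eq_square_sum _ _ (square_part 1 t)); last first.
  move=> i j ni nj; rewrite /square_part ni nj /= !ltnS !leqn0.
  case: ifPn => // ij; apply: t0; rewrite lt0n addn_eq0; exact: ij.
by rewrite square_sum_part// /square_sum !big_ord1.
Qed.

Lemma expansion_cst (a : C) u : expansion (cst_series a) 1 (fun=> a) u.
Proof.
have t0 i j h k : (0 < i + j)%N -> series_term (cst_series a) h k i j = 0.
  by rewrite lt0n addn_eq0 /series_term /cst_series => /negbTE ->; rewrite !mul0r.
split; [exact: ltr01| |].
  exists `|a| => -[|n]; first by rewrite /square_sum big_ord0.
  rewrite (@square_sum_cst `|a|)// => [i j ij|].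
    by rewrite /weighted_norm -[1]normr1 -norm_series_term t0 ?normr0.
  by rewrite /weighted_norm !mulr1.
move=> h k _ _; apply/cvgrPdist_lt => e e0; near=> n.
rewrite (@square_sum_cst a) ?subrr ?normr0//.
- by near: n; exact: nbhs_infty_gt.
- by move=> i j; exact: t0.
- by rewrite /series_term !mulr1.
Unshelve. all: by end_near.
Qed.

Lemma norm_leD c c' r M M' : 0 <= r -> norm_le c r M -> norm_le c' r M' ->
  norm_le (fun i j => c i j + c' i j) r (M + M').
Proof.
move=> r0 cM cM' n; apply: le_trans (lerD (cM n) (cM' n)).
rewrite -square_sumD; apply: ler_square_sum => i j.
by rewrite /weighted_norm -!mulrDl !ler_wpM2r ?exprn_ge0 ?ler_normD.
Qed.

Lemma expansionD c c' r f g u : expansion c r f u -> expansion c' r g u ->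
  expansion (fun i j => c i j + c' i j) r (fun v => f v + g v) u.
Proof.
move=> [r0 [M cM] cf] [_ [M' cM'] cg]; split; [exact: r0| |].
  by exists (M + M'); apply: norm_leD => //; exact: ltW.
move=> h k hr kr.
have -> : square_sum (series_term (fun i j => c i j + c' i j) h k) =
  (fun n => square_sum (series_term c h k) n + square_sum (series_term c' h k) n).
  apply/funext => n; rewrite -square_sumD; apply: eq_square_sum => i j _ _.
  by rewrite /series_term !mulrDl.
by apply: cvgD; [exact: cf|exact: cg].
Qed.

Definition cauchy_product c c' i j : C :=
  \sum_(a < i.+1) \sum_(b < j.+1) c a b * c' (i - a)%N (j - b)%N.

Let truncation c n : {poly {poly C}} := \poly_(i < n) \poly_(j < n) c i j.

Let coef_truncation c n i j : (truncation c n)`_i`_j = square_part n c i j.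
Proof.
rewrite /truncation coef_poly /square_part; case: ltnP => _; last by rewrite coef0.
by rewrite coef_poly.
Qed.

Let horner2_wide (q : {poly {poly C}}) N h k :
    (size q <= N)%N -> (forall i : nat, (size (q`_i)%R <= N)%N) ->
  q.[h%:P].[k] = square_sum (series_term (fun i j => q`_i`_j) h k) N.
Proof.
move=> qN qiN; rewrite (horner_coef_wide _ qN) horner_sum; apply: eq_bigr => i _.
rewrite -polyC_exp hornerM hornerC (horner_coef_wide _ (qiN _)) mulr_suml.
by apply: eq_bigr => j _; rewrite /series_term mulrAC.
Qed.

Let horner_truncation c n h k :
  (truncation c n).[h%:P].[k] = square_sum (series_term c h k) n.
Proof.
rewrite (@horner2_wide _ n) ?size_poly// => [|i].
  apply: eq_square_sum => i j ni nj.
  by rewrite /series_term coef_truncation /square_part ni nj.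
by apply/leq_sizeP => j nj; rewrite coef_truncation /square_part [(j < n)%N]ltnNge nj andbF.
Qed.

Lemma cauchy_product_part c c' n i j : (i < n)%N -> (j < n)%N ->
  cauchy_product (square_part n c) (square_part n c') i j = cauchy_product c c' i j.
Proof.
move=> ni nj; apply: eq_bigr => a _; apply: eq_bigr => b _.
have an : (a < n)%N by exact: leq_trans (ltn_ord a) ni.
have bn : (b < n)%N by exact: leq_trans (ltn_ord b) nj.
have ian : (i - a < n)%N by exact: leq_ltn_trans (leq_subr _ _) ni.
have jbn : (j - b < n)%N by exact: leq_ltn_trans (leq_subr _ _) nj.
by rewrite /square_part an bn ian jbn.
Qed.

Let coef_truncationM c c' n i j :
  (truncation c n * truncation c' n)`_i`_j =
  cauchy_product (square_part n c) (square_part n c') i j.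
Proof.
rewrite coefM coef_sum; apply: eq_bigr => a _; rewrite coefM.
by apply: eq_bigr => b _; rewrite !coef_truncation.
Qed.

(** Finite truncations are polynomials, whose product is exact; the truncated
    Cauchy product lives on a square of twice the size. *)
Lemma square_sumM c c' n h k :
  square_sum (series_term c h k) n * square_sum (series_term c' h k) n =
  square_sum (series_term (cauchy_product (square_part n c) (square_part n c')) h k) (n + n).
Proof.
rewrite -(horner_truncation c) -(horner_truncation c') -!hornerM (@horner2_wide _ (n + n)) => [|| i].
- by apply: eq_square_sum => i j _ _; rewrite /series_term coef_truncationM.
- rewrite (leq_trans (size_polyMleq _ _))// (leq_trans (leq_pred _))//.
  by rewrite leq_add ?size_poly.
- apply/leq_sizeP => j nj; rewrite coef_truncationM.
  apply: big1 => a _; apply: big1 => b _; rewrite /square_part.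
  case: (ltnP b n) => [bn|_]; last by rewrite andbF mul0r.
  suff -> : (j - b < n)%N = false by rewrite andbF mulr0.
  have bj : (b <= j)%N by rewrite -ltnS; exact: ltn_ord.
  apply/negbTE; rewrite -leqNgt (leq_subRL _ bj).
  by apply: leq_trans nj; rewrite leq_add2r ltnW.
Qed.

Lemma norm_cauchy_product_le c c' n i j :
  `|cauchy_product (square_part n c) (square_part n c') i j| <=
  cauchy_product (fun a b => `|c a b|) (fun a b => `|c' a b|) i j.
Proof.
apply: le_trans (ler_norm_sum _ _ _) _; apply: ler_sum => a _.
apply: le_trans (ler_norm_sum _ _ _) _; apply: ler_sum => b _.
rewrite normrM ler_pM// /square_part; by case: ifP; rewrite ?normr0.
Qed.

Lemma cauchy_product_norm_le c c' i j :
  `|cauchy_product c c' i j| <=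
  cauchy_product (fun a b => `|c a b|) (fun a b => `|c' a b|) i j.
Proof.
apply: le_trans (ler_norm_sum _ _ _) _; apply: ler_sum => a _.
apply: le_trans (ler_norm_sum _ _ _) _; apply: ler_sum => b _.
by rewrite normrM.
Qed.

Lemma cauchy_product_ge0 c c' i j : (forall a b, 0 <= c a b) ->
  (forall a b, 0 <= c' a b) -> 0 <= cauchy_product c c' i j.
Proof.
by move=> c0 c'0; apply: sumr_ge0 => a _; apply: sumr_ge0 => b _; rewrite mulr_ge0.
Qed.

Let majorantM c c' r n : 0 <= r ->
  square_sum (series_term (cauchy_product (fun a b => `|c a b|) (fun a b => `|c' a b|)) r r) n <=
  square_sum (weighted_norm c r) n * square_sum (weighted_norm c' r) n.
Proof.
move=> r0; rewrite (@square_sumM (fun a b => `|c a b|) (fun a b => `|c' a b|)).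
set d := (X in _ <= square_sum (series_term X _ _) _).
rewrite (@eq_square_sum _ _ (series_term d r r)); last first.
  by move=> i j ni nj; rewrite /series_term /d cauchy_product_part.
apply: square_sum_mono; last exact: leq_addr.
move=> i j; rewrite /series_term !mulr_ge0 ?exprn_ge0// cauchy_product_ge0// => a b;
  by rewrite /square_part; case: ifP.
Qed.

Lemma norm_leM c c' r M M' : 0 <= r -> norm_le c r M -> norm_le c' r M' ->
  norm_le (cauchy_product c c') r (M * M').
Proof.
move=> r0 cM cM' n; apply: le_trans (ler_pM _ _ (cM n) (cM' n)); last 2 first.
- by apply: square_sum_ge0 => i j; apply: weighted_norm_ge0.
- by apply: square_sum_ge0 => i j; apply: weighted_norm_ge0.
apply: le_trans (majorantM _ _ _ r0); apply: ler_square_sum => i j.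
by rewrite !ler_wpM2r ?exprn_ge0// cauchy_product_norm_le.
Qed.

(** The product of the partial sums and the partial sum of the Cauchy product
    have the same terms on the square of size [n]; the terms outside of it are
    dominated by the Cauchy product of the absolute values. *)
Lemma expansionM c c' r f g u : expansion c r f u -> expansion c' r g u ->
  expansion (cauchy_product c c') r (fun v => f v * g v) u.
Proof.
move=> [r0 [M cM] cf] [_ [M' cM'] cg]; split; [exact: r0| |].
  by exists (M * M'); apply: norm_leM => //; exact: ltW.
move=> h k hr kr.
have prodcvg : square_sum (series_term c h k) n * square_sum (series_term c' h k) n
    @[n --> \oo] --> f (u.1 + h, u.2 + k) * g (u.1 + h, u.2 + k).
  by apply: cvgM; [exact: cf|exact: cg].
pose d n i j := series_term (cauchy_product (square_part n c) (square_part n c')) h k i j -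
  square_part n (series_term (cauchy_product c c') h k) i j.
have dE n i j : d n i j = if (i < n)%N && (j < n)%N then 0 else
    series_term (cauchy_product (square_part n c) (square_part n c')) h k i j.
  rewrite /d /square_part; case: ifP => [/andP[ni nj]|_]; last by rewrite subr0.
  by rewrite /series_term cauchy_product_part// subrr.
have d0 : square_sum (d n) (n + n) @[n --> \oo] --> (0 : C).
  apply: (@dominated_square_sum _ _ (series_term (cauchy_product
    (fun a b => `|c a b|) (fun a b => `|c' a b|)) r r) (M * M')).
  - move=> i j; apply/cvgrPdist_lt => e e0; near=> n.
    rewrite dE ifT ?subrr ?normr0//; apply/andP; split.
      by near: n; exact: nbhs_infty_gt.
    by near: n; exact: nbhs_infty_gt.
  - move=> n i j; rewrite dE; case: ifP => _.
      rewrite normr0 /series_term !mulr_ge0 ?exprn_ge0 ?(ltW r0)//.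
      exact: cauchy_product_ge0.
    rewrite norm_series_term !ler_pM ?mulr_ge0 ?exprn_ge0 ?norm_cauchy_product_le//;
      by rewrite lerXn2r ?nnegrE// ltW.
  - move=> n; apply: le_trans (majorantM _ _ _ (ltW r0)) _.
    apply: ler_pM => //;
      by apply: square_sum_ge0 => i j; apply: weighted_norm_ge0; exact: ltW.
rewrite -[X in _ --> X]subr0.
have -> : square_sum (series_term (cauchy_product c c') h k) = (fun n =>
    square_sum (series_term c h k) n * square_sum (series_term c' h k) n -
    square_sum (d n) (n + n)).
  apply/funext => n; rewrite square_sumB square_sumM square_sum_part ?leq_addr//.
  by rewrite opprB addrC subrK.
exact: (cvgB prodcvg d0).
Unshelve. all: by end_near.
Qed.

End PowerSeriesAlgebra.

(** * Expansion at a nearby centre *)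

Section Recentering.
Variable R : realType.
Local Notation C := (Cplx R).
Implicit Types (c : nat -> nat -> C) (f g : C * C -> C) (u v : C * C) (r s h k M : C).

(** What the monomial of bidegree [(a, b)] contributes to the coefficient of
    bidegree [(i, j)] when the centre moves by [(h, k)]. *)
Definition recentering_term c h k i j a b : C :=
  c a b * (h ^+ (a - i) *+ 'C(a, i)) * (k ^+ (b - j) *+ 'C(b, j)).

Definition recentered c h k i j : C :=
  limn (square_sum (recentering_term c h k i j)).

Lemma square_sum_exchange (F : nat -> nat -> nat -> nat -> C) m n :
  square_sum (fun i j => square_sum (F i j) m) n =
  square_sum (fun a b => square_sum (fun i j => F i j a b) n) m.
Proof.
rewrite /square_sum.
under eq_bigr do rewrite exchange_big/=.
rewrite exchange_big/=; apply: eq_bigr => a _.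
under eq_bigr do rewrite exchange_big/=.
by rewrite exchange_big.
Qed.

Lemma square_sum_prod (x y : nat -> C) n :
  square_sum (fun i j => x i * y j) n = (\sum_(i < n) x i) * (\sum_(j < n) y j).
Proof. by rewrite mulr_suml; apply: eq_bigr => i _; rewrite mulr_sumr. Qed.

Let sum_binomial h k a n : (a < n)%N ->
  \sum_(i < n) (h ^+ (a - i) *+ 'C(a, i)) * k ^+ i = (h + k) ^+ a.
Proof.
move=> an; rewrite exprDn.
rewrite (big_ord_widen n (fun i => (h ^+ (a - i) * k ^+ i) *+ 'C(a, i)))//.
rewrite [RHS]big_mkcond; apply: eq_bigr => i _.
case: ltnP => [_|ai]; first by rewrite mulrnAl.
by rewrite bin_small ?mulr0n ?mul0r.
Qed.

Let recentering_square c h k h' k' n :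
  square_sum (fun i j => square_sum (recentering_term c h k i j) n * h' ^+ i * k' ^+ j) n =
  square_sum (series_term c (h + h') (k + k')) n.
Proof.
transitivity (square_sum (fun i j => square_sum (fun a b =>
    recentering_term c h k i j a b * (h' ^+ i * k' ^+ j)) n) n).
  apply: eq_square_sum => i j _ _; rewrite -mulrA mulrC -square_sumZ.
  by apply: eq_square_sum => a b _ _; rewrite mulrC.
rewrite square_sum_exchange; apply: eq_square_sum => a b na nb.
rewrite /series_term -(sum_binomial h h' na) -(sum_binomial k k' nb) -mulrA.
rewrite -(square_sum_prod (fun i => (h ^+ (a - i) *+ 'C(a, i)) * h' ^+ i)
  (fun j => (k ^+ (b - j) *+ 'C(b, j)) * k' ^+ j)).
rewrite -square_sumZ; apply: eq_square_sum => i j _ _.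
by rewrite /recentering_term; ring.
Qed.

Let norm_recentering_term c h k s i j a b : `|h| <= s -> `|k| <= s ->
  `|recentering_term c h k i j a b| <=
  recentering_term (fun a b => `|c a b|) s s i j a b.
Proof.
move=> hs ks; have s0 : 0 <= s by exact: le_trans hs.
rewrite /recentering_term !normrM !normrMn !normrX.
rewrite !ler_pM ?mulr_ge0 ?mulrn_wge0 ?exprn_ge0// lerMn2r;
  by rewrite lerXn2r ?orbT// nnegrE.
Qed.

Section Majorant.
Variables (c : nat -> nat -> C) (s M : C).
Hypothesis s0 : 0 < s.
Hypothesis cM : norm_le c (s + s) M.

Let abs := fun a b => `|c a b|.

Let term_ge0 i j a b : 0 <= recentering_term abs s s i j a b.
Proof.
by rewrite /recentering_term !mulr_ge0 ?mulrn_wge0 ?exprn_ge0 ?(ltW s0) ?normr_ge0.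
Qed.

(** The binomial expansions of [(s + s) ^+ a] and [(s + s) ^+ b] bound the
    coefficients at all the nearby centres at once. *)
Let majorant_le n N :
  square_sum (fun i j => square_sum (recentering_term abs s s i j) n * s ^+ i * s ^+ j) N <= M.
Proof.
have square_ge0 m i j : 0 <= square_sum (recentering_term abs s s i j) m.
  exact: square_sum_ge0.
apply: le_trans (cM (maxn n N)).
rewrite (@eq_square_sum _ (weighted_norm _ _) (series_term abs (s + s) (s + s)))//.
rewrite -recentering_square.
apply: le_trans (square_sum_mono _ (leq_maxr n N)) _.
  by move=> i j; rewrite !mulr_ge0 ?exprn_ge0 ?(ltW s0) ?square_ge0.
apply: ler_square_sum => i j; rewrite !ler_wpM2r ?exprn_ge0 ?(ltW s0)//.
exact: square_sum_mono (leq_maxl _ _).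
Qed.

Let majorant1 n i j :
  square_sum (recentering_term abs s s i j) n <= M / (s ^+ i * s ^+ j).
Proof.
rewrite ler_pdivlMr ?mulr_gt0 ?exprn_gt0//.
apply: le_trans (majorant_le n (maxn i j).+1).
set w := (X in _ <= square_sum X _); have w0 a b : 0 <= w a b.
  rewrite /w !mulr_ge0 ?exprn_ge0 ?(ltW s0)//; exact: square_sum_ge0.
rewrite [leLHS]mulrA -[leLHS]/(w i j) /square_sum.
have ii : (i < (maxn i j).+1)%N by rewrite ltnS leq_maxl.
have jj : (j < (maxn i j).+1)%N by rewrite ltnS leq_maxr.
rewrite (bigD1 (Ordinal ii))//= (bigD1 (Ordinal jj))//= -addrA lerDl.
by rewrite addr_ge0 ?sumr_ge0// => a _; rewrite sumr_ge0.
Qed.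

Lemma norm_recentering_square_le h k i j n : `|h| <= s -> `|k| <= s ->
  square_sum (fun a b => `|recentering_term c h k i j a b|) n <= M / (s ^+ i * s ^+ j).
Proof.
move=> hs ks; apply: le_trans (majorant1 n i j); apply: ler_square_sum => a b.
exact: norm_recentering_term.
Qed.

Lemma recentered_cvg h k i j : `|h| <= s -> `|k| <= s ->
  square_sum (recentering_term c h k i j) @ \oo --> recentered c h k i j.
Proof.
move=> hs ks.
have [l lP] := square_sum_cvg (fun n => norm_recentering_square_le i j n hs ks).
by rewrite /recentered; have -> := cvg_lim (@norm_hausdorff _ C) lP.
Qed.

Lemma recentered_majorant : exists w : nat -> nat -> C,
  (forall n, square_sum w n <= M) /\
  forall n h k i j, `|h| <= s -> `|k| <= s ->
    `|square_sum (recentering_term c h k i j) n * s ^+ i * s ^+ j| <= w i j.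
Proof.
have lims i j : exists l : C, square_sum (recentering_term abs s s i j) @ \oo --> l.
  apply: (@square_sum_cvg _ _ (M / (s ^+ i * s ^+ j))) => n.
  apply: le_trans (majorant1 n i j); apply: ler_square_sum => a b.
  by rewrite ger0_norm.
pose w i j : C := limn (square_sum (recentering_term abs s s i j)).
have wP i j : square_sum (recentering_term abs s s i j) @ \oo --> w i j.
  by have [l lP] := lims i j; rewrite /w (cvg_lim (@norm_hausdorff _ C) lP).
exists (fun i j => w i j * s ^+ i * s ^+ j); split=> [N|n h k i j hs ks].
  rewrite -subr_ge0; apply: (@lim_ge0 _ (fun n => M -
      square_sum (fun i j => square_sum (recentering_term abs s s i j) n * s ^+ i * s ^+ j) N)
    _ 0) => [|n _]; last by rewrite subr_ge0 majorant_le.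
  apply: cvgB; first exact: cvg_cst.
  apply: (@cvg_square_sum_fixed _ (fun n i j =>
    square_sum (recentering_term abs s s i j) n * s ^+ i * s ^+ j)) => i j.
  by apply: cvgM; [apply: cvgM; [exact: wP|exact: cvg_cst]|exact: cvg_cst].
have sX m : 0 <= s ^+ m by rewrite exprn_ge0// ltW.
rewrite 2!normrM !(ger0_norm (sX _)) !ler_wpM2r//.
apply: le_trans (square_sum_norm _ _) _.
apply: le_trans (_ : square_sum (recentering_term abs s s i j) n <= _).
  by apply: ler_square_sum => a b; exact: norm_recentering_term.
rewrite -subr_ge0; apply: (@lim_ge0 _ (fun m => square_sum (recentering_term abs s s i j) m -
   square_sum (recentering_term abs s s i j) n) _ n) => [|m nm].
  by apply: cvgB; [exact: wP|exact: cvg_cst].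
by rewrite subr_ge0 square_sum_mono.
Qed.

End Majorant.

(** A truncation is a polynomial, recentered exactly by the binomial theorem; the
    majorant allows passing to the limit in the coefficients. *)
Lemma expansion_recentered c r f u h k : expansion c r f u ->
  `|h| < r / 2 -> `|k| < r / 2 ->
  expansion (recentered c h k) (r / 2) f (u.1 + h, u.2 + k).
Proof.
move=> [r0 [M cM] cf]; rewrite [r in norm_le _ r]splitr in cM.
have s0 : 0 < r / 2 by rewrite divr_gt0.
have rss : r = r / 2 + r / 2 by exact: splitr.
move: (r / 2) s0 cM rss => s s0 cM rss hs ks.
have [w [wM wP]] := recentered_majorant s0 cM.
have rec_cvg i j : square_sum (recentering_term c h k i j) @ \oo --> recentered c h k i j.
  by apply: (recentered_cvg s0 cM); exact: ltW.
have w' i j : `|recentered c h k i j * s ^+ i * s ^+ j| <= w i j.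
  apply: (@norm_lim_le _ (fun n => square_sum (recentering_term c h k i j) n * s ^+ i * s ^+ j)
    _ _ 0) => [|n _].
    by apply: cvgM; [apply: cvgM; [exact: rec_cvg|exact: cvg_cst]|exact: cvg_cst].
  by apply: wP; exact: ltW.
split; [exact: s0| |].
  exists M => n; apply: le_trans (wM n); apply: ler_square_sum => i j.
  apply: le_trans (w' i j); rewrite 2!normrM !normrX.
  by rewrite (gtr0_norm s0).
move=> h' k' hs' ks' /=.
pose d n i j := (square_sum (recentering_term c h k i j) n - recentered c h k i j) *
  h' ^+ i * k' ^+ j.
have d0 : square_sum (d n) n @[n --> \oo] --> (0 : C).
  apply: (@dominated_square_sum _ d (fun i j => w i j + w i j) (M + M) id).
  - move=> i j; rewrite -[X in _ --> X](mul0r (k' ^+ j)) -(mul0r (h' ^+ i)).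
    apply: cvgM; last exact: cvg_cst.
    apply: cvgM; last exact: cvg_cst.
    rewrite -(subrr (recentered c h k i j)).
    by apply: cvgB; [exact: rec_cvg|exact: cvg_cst].
  - move=> n i j; apply: le_trans (_ : `|(square_sum (recentering_term c h k i j) n -
        recentered c h k i j) * s ^+ i * s ^+ j| <= _).
      rewrite !normrM !normrX (gtr0_norm s0).
      rewrite !ler_pM ?mulr_ge0 ?exprn_ge0// lerXn2r ?nnegrE// ltW//.
    rewrite mulrBl mulrBl; apply: le_trans (ler_normB _ _) _.
    by rewrite lerD// wP// ltW.
  - by move=> n; rewrite square_sumD lerD.
rewrite -[X in _ --> X]subr0.
have -> : square_sum (series_term (recentered c h k) h' k') = (fun n =>
    square_sum (series_term c (h + h') (k + k')) n - square_sum (d n) n).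
  apply/funext => n; rewrite -recentering_square -square_sumB.
  by apply: eq_square_sum => i j _ _; rewrite /d /series_term; ring.
apply: cvgB d0; rewrite -!addrA; apply: cf; rewrite rss.
  by apply: le_lt_trans (ler_normD _ _) _; rewrite ltrD.
by apply: le_lt_trans (ler_normD _ _) _; rewrite ltrD.
Qed.

End Recentering.

(** * Analyticity of the derivatives *)

Section AnalyticCalculus.
Variable R : realType.
Local Notation C := (Cplx R).
Implicit Types (c : nat -> nat -> C) (f g : C * C -> C) (u v : C * C) (r s h k M : C).

Lemma analytic_near f u : analytic_at f u -> \forall v \near u, analytic_at f v.
Proof.
move=> /analytic_atP[c [r cf]]; have [r0 _ _] := cf.
apply/nbhs_polydisc; exists (r / 2); first by rewrite divr_gt0.
move=> h k hr kr; apply/analytic_atP; exists (recentered c h k), (r / 2).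
exact: expansion_recentered.
Qed.

Definition dx_series c i j : C := c i.+1 j *+ i.+1.
Definition dy_series c i j : C := c i j.+1 *+ j.+1.

(** The differentiated terms of a square come from a rectangle with one more row
    than columns, hence the correction by the last column of the next square. *)
Let square_sum_dx_series c h k n :
  square_sum (series_term (dx_series c) h k) n =
  square_sum (recentering_term c h k 1 0) n.+1 -
  square_sum (fun a b => if (b < n)%N then 0 else recentering_term c h k 1 0 a b) n.+1.
Proof.
rewrite -square_sumB.
transitivity (square_sum (fun a b =>
    if (b < n)%N then recentering_term c h k 1 0 a b else 0) n.+1); last first.
  by apply: eq_square_sum => a b _ _; case: ifP => _; rewrite ?subr0 ?subrr.
rewrite /square_sum [RHS]big_ord_recl [X in _ = X + _]big1 ?add0r => [|j _].
  apply: eq_bigr => i _; rewrite big_ord_recr /= ltnn addr0.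
  apply: eq_bigr => j _; rewrite ltn_ord /series_term /dx_series /recentering_term.
  by rewrite bin1 bin0 /bump /= add1n subn1 subn0 /=; ring.
by rewrite /recentering_term bin0n mulr0n mulr0 mul0r; case: ifP.
Qed.

(** At a nearby point the derivative is the coefficient of bidegree [(1, 0)] of
    the expansion recentered there, and this coefficient is the sum of the
    differentiated series. *)
Lemma expansion_dx_series c r f u : expansion c r f u ->
  expansion (dx_series c) (r / 2) (dx f) u.
Proof.
move=> cf; have [r0 [M cM] _] := cf.
have s0 : 0 < r / 2 by rewrite divr_gt0.
rewrite [r in norm_le _ r]splitr in cM.
have bound h k n := norm_recentering_square_le s0 cM (h := h) (k := k) 1 0 n.
split; [exact: s0| |].
  exists (M / (r / 2)) => n.
  have := bound (r / 2) (r / 2) n.+1; rewrite gtr0_norm// expr1 expr0 mulr1.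
  move=> /(_ (lexx _) (lexx _)); apply: le_trans.
  have -> : square_sum (weighted_norm (dx_series c) (r / 2)) n =
    square_sum (series_term (dx_series (fun a b => `|c a b|)) (r / 2) (r / 2)) n.
    by apply: eq_square_sum => i j _ _; rewrite /weighted_norm /dx_series normrMn.
  rewrite square_sum_dx_series -square_sumB; apply: ler_square_sum => a b.
  have E : recentering_term (fun a b => `|c a b|) (r / 2) (r / 2) 1 0 a b =
      `|recentering_term c (r / 2) (r / 2) 1 0 a b|.
    by rewrite /recentering_term !normrM !normrMn !normrX (gtr0_norm s0).
  by rewrite E; case: ifP => _; rewrite ?subr0 ?subrr.
move=> h k hs ks.
rewrite (expansion_dx (expansion_recentered cf hs ks)).
have tail0 : square_sum (fun a b => if (b < n)%N then 0 else
    recentering_term c h k 1 0 a b) n.+1 @[n --> \oo] --> (0 : C).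
  apply: (@dominated_square_sum _ (fun n a b => if (b < n)%N then 0 else
    recentering_term c h k 1 0 a b) (fun a b => `|recentering_term c h k 1 0 a b|)
    (M / ((r / 2) ^+ 1 * (r / 2) ^+ 0)) S).
  - move=> a b; apply/cvgrPdist_lt => e e0; near=> n.
    rewrite ifT ?subrr ?normr0//; near: n; exact: nbhs_infty_gt.
  - by move=> n a b; case: ifP => _; rewrite ?normr0.
  - by move=> n; apply: bound; exact: ltW.
rewrite -[X in _ --> X]subr0.
have -> : square_sum (series_term (dx_series c) h k) = (fun n =>
  square_sum (recentering_term c h k 1 0) n.+1 -
  square_sum (fun a b => if (b < n)%N then 0 else recentering_term c h k 1 0 a b) n.+1).
  by apply/funext => n; exact: square_sum_dx_series.
apply: cvgB tail0.
have cv : square_sum (recentering_term c h k 1 0) @ \oo --> recentered c h k 1 0.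
  by apply: (recentered_cvg s0 cM); exact: ltW.
by rewrite -(cvg_shiftS (square_sum (recentering_term c h k 1 0))) in cv.
Unshelve. all: by end_near.
Qed.

Let swap (u : C * C) : C * C := (u.2, u.1).

(** Exchanging the variables reduces [dy] to [dx]. *)
Lemma expansion_swap c r f u : expansion c r f u ->
  expansion (fun i j => c j i) r (f \o swap) (swap u).
Proof.
move=> [r0 [M cM] cf]; split; [exact: r0| |].
  exists M => n; apply: le_trans (cM n); rewrite /square_sum exchange_big/=.
  by apply: ler_sum => i _; apply: ler_sum => j _; rewrite /weighted_norm mulrAC.
move=> h k hr kr.
have -> : square_sum (series_term (fun i j => c j i) h k) = square_sum (series_term c k h).
  apply/funext => n; rewrite /square_sum exchange_big/=.
  by apply: eq_bigr => i _; apply: eq_bigr => j _; rewrite /series_term mulrAC.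
exact: cf.
Qed.

Let dx_swap f u : dx (f \o swap) (swap u) = dy f u.
Proof.
rewrite /dx /dy /derive.
suff -> : (fun h : C => h^-1 *: (((f \o swap) \o shift (swap u)) (h *: ((1, 0) : C * C)) -
    (f \o swap) (swap u))) =
  (fun h : C => h^-1 *: ((f \o shift u) (h *: ((0, 1) : C * C)) - f u)) by [].
by apply/funext => h; case: u => x y.
Qed.

Lemma expansion_dy_series c r f u : expansion c r f u ->
  expansion (dy_series c) (r / 2) (dy f) u.
Proof.
move=> /expansion_swap /expansion_dx_series /expansion_swap; case: u => x y.
have -> : dx (f \o swap) \o swap = dy f by apply/funext => v; exact: dx_swap.
by [].
Qed.

End AnalyticCalculus.

(** * Differential calculus of analytic functions *)

Section AnalyticRing.
Variable R : realType.
Local Notation C := (Cplx R).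
Implicit Types (f g : C * C -> C) (u v : C * C) (X Y : vfield R).

Lemma common_expansion f g u : analytic_at f u -> analytic_at g u ->
  exists c c' r, expansion c r f u /\ expansion c' r g u.
Proof.
move=> /analytic_atP[c [r cf]] /analytic_atP[c' [r' cg]].
have [[r0 _ _] [r'0 _ _]] := (cf, cg).
have [s [s0 sr sr']] := exists_le_both r0 r'0.
exists c, c', s; split; first exact: expansion_shrink cf.
exact: expansion_shrink cg.
Qed.

Lemma analytic_cst (a : C) u : analytic_at (fun=> a) u.
Proof. by apply/analytic_atP; exists (cst_series a), 1; exact: expansion_cst. Qed.

Lemma analyticD f g u : analytic_at f u -> analytic_at g u ->
  analytic_at (fun v => f v + g v) u.
Proof.
move=> fu gu; have [c [c' [r [cf cg]]]] := common_expansion fu gu.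
by apply/analytic_atP; exists (fun i j => c i j + c' i j), r; exact: expansionD.
Qed.

Lemma analyticM f g u : analytic_at f u -> analytic_at g u ->
  analytic_at (fun v => f v * g v) u.
Proof.
move=> fu gu; have [c [c' [r [cf cg]]]] := common_expansion fu gu.
by apply/analytic_atP; exists (cauchy_product c c'), r; exact: expansionM.
Qed.

Lemma analyticN f u : analytic_at f u -> analytic_at (fun v => - f v) u.
Proof.
move=> fu; rewrite (_ : (fun v => - f v) = (fun v => (-1) * f v)).
  by apply: analyticM; [exact: analytic_cst|exact: fu].
by apply/funext => v; rewrite mulN1r.
Qed.

Lemma analyticB f g u : analytic_at f u -> analytic_at g u ->
  analytic_at (fun v => f v - g v) u.
Proof. by move=> fu gu; apply: analyticD; [exact: fu|exact: analyticN]. Qed.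

Lemma analytic_sum (I : Type) (s : seq I) (P : pred I) (F : I -> C * C -> C) u :
  (forall i, P i -> analytic_at (F i) u) ->
  analytic_at (fun v => \sum_(i <- s | P i) F i v) u.
Proof.
move=> Fu; elim: s => [|i s IH].
  rewrite (_ : (fun v => _) = fun=> 0); first exact: analytic_cst.
  by apply/funext => v; rewrite big_nil.
case Pi : (P i); last first.
  rewrite (_ : (fun v => _) = fun v => \sum_(i <- s | P i) F i v); first exact: IH.
  by apply/funext => v; rewrite big_cons Pi.
rewrite (_ : (fun v => _) = fun v => F i v + \sum_(i <- s | P i) F i v).
  by apply: analyticD; [exact: Fu|exact: IH].
by apply/funext => v; rewrite big_cons Pi.
Qed.

Lemma analytic_prod (I : Type) (s : seq I) (P : pred I) (F : I -> C * C -> C) u :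
  (forall i, P i -> analytic_at (F i) u) ->
  analytic_at (fun v => \prod_(i <- s | P i) F i v) u.
Proof.
move=> Fu; elim: s => [|i s IH].
  rewrite (_ : (fun v => _) = fun=> 1); first exact: analytic_cst.
  by apply/funext => v; rewrite big_nil.
case Pi : (P i); last first.
  rewrite (_ : (fun v => _) = fun v => \prod_(i <- s | P i) F i v); first exact: IH.
  by apply/funext => v; rewrite big_cons Pi.
rewrite (_ : (fun v => _) = fun v => F i v * \prod_(i <- s | P i) F i v).
  by apply: analyticM; [exact: Fu|exact: IH].
by apply/funext => v; rewrite big_cons Pi.
Qed.

Lemma analyticX f n u : analytic_at f u -> analytic_at (fun v => f v ^+ n) u.
Proof.
move=> fu; elim: n => [|n IH]; first exact: analytic_cst.
rewrite (_ : (fun v => _) = fun v => f v * f v ^+ n); first exact: analyticM.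
by apply/funext => v; rewrite exprS.
Qed.

Lemma analytic_mulrn f n u : analytic_at f u -> analytic_at (fun v => f v *+ n) u.
Proof.
move=> fu; rewrite (_ : (fun v => _) = fun v => n%:R * f v).
  by apply: analyticM; [exact: analytic_cst|exact: fu].
by apply/funext => v; rewrite mulr_natl.
Qed.

Lemma analytic_dx f u : analytic_at f u -> analytic_at (dx f) u.
Proof.
move=> /analytic_atP[c [r cf]]; apply/analytic_atP; exists (dx_series c), (r / 2).
exact: expansion_dx_series.
Qed.

Lemma analytic_dy f u : analytic_at f u -> analytic_at (dy f) u.
Proof.
move=> /analytic_atP[c [r cf]]; apply/analytic_atP; exists (dy_series c), (r / 2).
exact: expansion_dy_series.
Qed.

Lemma dx_near_eq f g u : (\forall v \near u, f v = g v) -> dx f u = dx g u.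
Proof. exact: near_eq_derive. Qed.

Lemma dy_near_eq f g u : (\forall v \near u, f v = g v) -> dy f u = dy g u.
Proof. exact: near_eq_derive. Qed.

Lemma dx_cst (a : C) u : dx (fun=> a) u = 0.
Proof. by rewrite (expansion_dx (expansion_cst a u)). Qed.

Lemma dy_cst (a : C) u : dy (fun=> a) u = 0.
Proof. by rewrite (expansion_dy (expansion_cst a u)). Qed.

Lemma dxD f g u : analytic_at f u -> analytic_at g u ->
  dx (fun v => f v + g v) u = dx f u + dx g u.
Proof.
move=> fu gu; have [c [c' [r [cf cg]]]] := common_expansion fu gu.
by rewrite (expansion_dx (expansionD cf cg)) (expansion_dx cf) (expansion_dx cg).
Qed.

Lemma dyD f g u : analytic_at f u -> analytic_at g u ->
  dy (fun v => f v + g v) u = dy f u + dy g u.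
Proof.
move=> fu gu; have [c [c' [r [cf cg]]]] := common_expansion fu gu.
by rewrite (expansion_dy (expansionD cf cg)) (expansion_dy cf) (expansion_dy cg).
Qed.

Lemma dxM f g u : analytic_at f u -> analytic_at g u ->
  dx (fun v => f v * g v) u = dx f u * g u + f u * dx g u.
Proof.
move=> fu gu; have [c [c' [r [cf cg]]]] := common_expansion fu gu.
rewrite (expansion_dx (expansionM cf cg)) (expansion_dx cf) (expansion_dx cg).
rewrite (expansion_coef00 cf) (expansion_coef00 cg) /cauchy_product.
by rewrite !(big_ord_recl, big_ord0) /= !addr0 addrC.
Qed.

Lemma dyM f g u : analytic_at f u -> analytic_at g u ->
  dy (fun v => f v * g v) u = dy f u * g u + f u * dy g u.
Proof.
move=> fu gu; have [c [c' [r [cf cg]]]] := common_expansion fu gu.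
rewrite (expansion_dy (expansionM cf cg)) (expansion_dy cf) (expansion_dy cg).
rewrite (expansion_coef00 cf) (expansion_coef00 cg) /cauchy_product.
by rewrite !(big_ord_recl, big_ord0) /= !addr0 addrC.
Qed.

Lemma dxN f u : analytic_at f u -> dx (fun v => - f v) u = - dx f u.
Proof.
move=> fu; have := dxD fu (analyticN fu).
rewrite (_ : (fun v => f v + - f v) = fun=> 0); last by apply/funext => v; rewrite subrr.
by rewrite dx_cst => /eqP; rewrite eq_sym addrC addr_eq0 => /eqP.
Qed.

Lemma dyN f u : analytic_at f u -> dy (fun v => - f v) u = - dy f u.
Proof.
move=> fu; have := dyD fu (analyticN fu).
rewrite (_ : (fun v => f v + - f v) = fun=> 0); last by apply/funext => v; rewrite subrr.
by rewrite dy_cst => /eqP; rewrite eq_sym addrC addr_eq0 => /eqP.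
Qed.

Lemma dxB f g u : analytic_at f u -> analytic_at g u ->
  dx (fun v => f v - g v) u = dx f u - dx g u.
Proof. by move=> fu gu; rewrite (dxD fu (analyticN gu)) (dxN gu). Qed.

Lemma dyB f g u : analytic_at f u -> analytic_at g u ->
  dy (fun v => f v - g v) u = dy f u - dy g u.
Proof. by move=> fu gu; rewrite (dyD fu (analyticN gu)) (dyN gu). Qed.

(** Both sides are the coefficient of bidegree [(1, 1)]. *)
Lemma dx_dy f u : analytic_at f u -> dx (dy f) u = dy (dx f) u.
Proof.
move=> /analytic_atP[c [r cf]].
rewrite (expansion_dx (expansion_dy_series cf)) (expansion_dy (expansion_dx_series cf)).
by [].
Qed.

Lemma analytic_vf_apply X f u : analytic_at X.1 u -> analytic_at X.2 u ->
  analytic_at f u -> analytic_at (vf_apply X f) u.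
Proof.
move=> X1 X2 fu; rewrite /vf_apply.
exact: (analyticD (analyticM X1 (analytic_dx fu)) (analyticM X2 (analytic_dy fu))).
Qed.

Lemma vf_apply_near_eq X f g u :
  (\forall v \near u, f v = g v) -> vf_apply X f u = vf_apply X g u.
Proof. by move=> fg; rewrite /vf_apply (dx_near_eq fg) (dy_near_eq fg). Qed.

Lemma vf_apply_cst X (a : C) u : vf_apply X (fun=> a) u = 0.
Proof. by rewrite /vf_apply (dx_cst a u) (dy_cst a u) !mulr0 addr0. Qed.

Lemma vf_applyD X f g u : analytic_at f u -> analytic_at g u ->
  vf_apply X (fun v => f v + g v) u = vf_apply X f u + vf_apply X g u.
Proof.
move=> fu gu; rewrite /vf_apply (dxD fu gu) (dyD fu gu).
by move: (dx f u) (dx g u) (dy f u) (dy g u) (X.1 u) (X.2 u) => *; ring.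
Qed.

Lemma vf_applyB X f g u : analytic_at f u -> analytic_at g u ->
  vf_apply X (fun v => f v - g v) u = vf_apply X f u - vf_apply X g u.
Proof.
move=> fu gu; rewrite /vf_apply (dxB fu gu) (dyB fu gu).
by move: (dx f u) (dx g u) (dy f u) (dy g u) (X.1 u) (X.2 u) => *; ring.
Qed.

Lemma vf_applyM X f g u : analytic_at f u -> analytic_at g u ->
  vf_apply X (fun v => f v * g v) u = vf_apply X f u * g u + f u * vf_apply X g u.
Proof.
move=> fu gu; rewrite /vf_apply (dxM fu gu) (dyM fu gu).
move: (dx f u) (dx g u) (dy f u) (dy g u) (f u) (g u) (X.1 u) (X.2 u) => *.
by ring.
Qed.

(** The second derivatives cancel because partial derivatives commute. *)
Lemma vf_apply_bracket X Y f u :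
    analytic_at X.1 u -> analytic_at X.2 u ->
    analytic_at Y.1 u -> analytic_at Y.2 u -> analytic_at f u ->
  vf_apply (vf_bracket X Y) f u =
  vf_apply X (vf_apply Y f) u - vf_apply Y (vf_apply X f) u.
Proof.
move=> X1 X2 Y1 Y2 fu.
have fx := analytic_dx fu; have fy := analytic_dy fu.
have apply2 Z Z' : analytic_at Z'.1 u -> analytic_at Z'.2 u ->
    vf_apply Z (vf_apply Z' f) u =
    vf_apply Z Z'.1 u * dx f u + Z'.1 u * (Z.1 u * dx (dx f) u + Z.2 u * dy (dx f) u) +
    (vf_apply Z Z'.2 u * dy f u + Z'.2 u * (Z.1 u * dy (dx f) u + Z.2 u * dy (dy f) u)).
  move=> Z1 Z2.
  apply: etrans (vf_applyD Z (analyticM Z1 fx) (analyticM Z2 fy)) _.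
  congr (_ + _); first exact: vf_applyM.
  apply: etrans (vf_applyM Z Z2 fy) _.
  by rewrite [vf_apply Z (dy f) u]/vf_apply (dx_dy fu).
(* stated for arbitrary numbers, so that comparing the terms of the identity
   never unfolds a derivative *)
have cancel (p q p' q' x1 x2 y1 y2 fx' fy' fxx fxy fyy : C) :
    (p * fx' + y1 * (x1 * fxx + x2 * fxy) + (q * fy' + y2 * (x1 * fxy + x2 * fyy))) -
    (p' * fx' + x1 * (y1 * fxx + y2 * fxy) + (q' * fy' + x2 * (y1 * fxy + y2 * fyy))) =
    (p - p') * fx' + (q - q') * fy' by ring.
apply/esym/(etrans (congr2 (fun a b => a - b) (apply2 X Y Y1 Y2) (apply2 Y X X1 X2))).
exact: cancel.
Qed.

End AnalyticRing.

(** * Analytic fixed points *)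

Section ImplicitFunction.
Variable R : realType.
Local Notation C := (Cplx R).
Implicit Types (c w e : nat -> nat -> C) (f : C * C -> C) (u v : C * C).

Lemma norm_le_ge0 c r M : norm_le c r M -> 0 <= M.
Proof. by move=> /(_ 0); rewrite /square_sum big_ord0. Qed.

Lemma norm_leW c r M M' : M <= M' -> norm_le c r M -> norm_le c r M'.
Proof. by move=> MM' cM n; apply: le_trans MM'. Qed.

(** A series without constant term gets small on a small polydisc. *)
Lemma norm_le_scale c r M t : 0 <= r -> 0 <= t -> t <= 1 -> c 0 0 = 0 ->
  norm_le c r M -> norm_le c (t * r) (t * M).
Proof.
move=> r0 t0 t1 c00 cM n; apply: le_trans (ler_wpM2l t0 (cM n)).
rewrite -square_sumZ; apply: ler_square_sum => i j.
have [ij|ij] := posnP (i + j).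
  move/eqP: ij; rewrite addn_eq0 => /andP[/eqP-> /eqP->].
  by rewrite /weighted_norm c00 normr0 !mul0r mulr0.
rewrite (_ : weighted_norm c (t * r) i j = t ^+ (i + j) * weighted_norm c r i j).
  rewrite ler_wpM2r ?weighted_norm_ge0// -[leRHS]expr1.
  exact: ler_wiXn2l.
by rewrite /weighted_norm !exprMn exprD; ring.
Qed.

Lemma norm_le_shrink c r s M : 0 <= s -> s <= r -> norm_le c r M -> norm_le c s M.
Proof.
move=> s0 sr cM n; apply: le_trans (cM n); apply: ler_square_sum => i j.
exact: ler_weighted_norm.
Qed.

(** Equality modulo the terms of total degree at least [m]. *)
Definition agree m c c' := forall i j, (i + j < m)%N -> c i j = c' i j.

Lemma agreeM m c c' e e' : agree m c c' -> agree m e e' ->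
  agree m (cauchy_product c e) (cauchy_product c' e').
Proof.
move=> cc' ee' i j ij; apply: eq_bigr => a _; apply: eq_bigr => b _.
have ai : (a <= i)%N by rewrite -ltnS; exact: ltn_ord.
have bj : (b <= j)%N by rewrite -ltnS; exact: ltn_ord.
rewrite cc' ?ee'//; first exact: leq_ltn_trans (leq_add (leq_subr _ _) (leq_subr _ _)) ij.
exact: leq_ltn_trans (leq_add ai bj) ij.
Qed.

(** As all the factors vanish at the centre, a coefficient of degree [m] of the
    products involves only coefficients of degree less than [m]. *)
Lemma agreeM_succ m c c' e e' : c 0 0 = 0 -> c' 0 0 = 0 -> e 0 0 = 0 -> e' 0 0 = 0 ->
  agree m c c' -> agree m e e' ->
  agree m.+1 (cauchy_product c e) (cauchy_product c' e').
Proof.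
move=> c0 c'0 e0 e'0 cc' ee' i j; rewrite ltnS => ij.
apply: eq_bigr => a _; apply: eq_bigr => b _.
have ai : (a <= i)%N by rewrite -ltnS; exact: ltn_ord.
have bj : (b <= j)%N by rewrite -ltnS; exact: ltn_ord.
have [ab0|ab0] := posnP (a + b).
  by move/eqP: ab0; rewrite addn_eq0 => /andP[/eqP-> /eqP->]; rewrite c0 c'0 !mul0r.
have [ab|ab] := ltnP (a + b) (i + j).
  rewrite cc' ?(leq_trans ab)// ee'//; apply: leq_trans ij.
  have -> : (i + j = (a + b) + ((i - a) + (j - b)))%N by rewrite addnACA !subnKC.
  by rewrite -[X in (X < _)%N]add0n ltn_add2r.
have abE : (a + b = i + j)%N by apply/eqP; rewrite eqn_leq ab leq_add.
have aE : (i - a = 0)%N.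
  apply/eqP; rewrite subn_eq0 -(leq_add2r b) abE leq_add2l; exact: bj.
have bE : (j - b = 0)%N.
  apply/eqP; rewrite subn_eq0 -(leq_add2l a) abE leq_add2r; exact: ai.
by rewrite aE bE e0 e'0 !mulr0.
Qed.

Fixpoint horner_series (cs : nat -> nat -> nat -> C) n k w : nat -> nat -> C :=
  if n is n'.+1 then
    fun i j => cs k i j + cauchy_product w (horner_series cs n' k.+1 w) i j
  else cst_series 0.

Fixpoint horner_fun (gs : nat -> C * C -> C) n k (x : C) v : C :=
  if n is n'.+1 then gs k v + x * horner_fun gs n' k.+1 x v else 0.

Lemma horner_funE gs n k x v :
  horner_fun gs n k x v = \sum_(i < n) gs (k + i)%N v * x ^+ i.
Proof.
elim: n k => [|n IH] k; first by rewrite big_ord0.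
rewrite big_ord_recl /= addn0 expr0 mulr1 IH mulr_sumr; congr (_ + _).
by apply: eq_bigr => i _; rewrite /bump /= addSnnS exprS; ring.
Qed.

Lemma expansion_horner cs gs r n k w f u : 0 < r -> r <= 1 ->
  (forall l, expansion (cs l) r (gs l) u) -> expansion w r f u ->
  expansion (horner_series cs n k w) r (fun v => horner_fun gs n k (f v) v) u.
Proof.
move=> r0 r1 csgs wf; elim: n k => [|n IH] k /=.
  exact: expansion_shrink (expansion_cst _ _).
exact: (expansionD (csgs k) (expansionM wf (IH k.+1))).
Qed.

Lemma agree_horner cs m n k w w' : agree m w w' ->
  agree m (horner_series cs n k w) (horner_series cs n k w').
Proof.
move=> ww'; elim: n k => [//|n IH] k i j ij /=; congr (_ + _).
exact: (agreeM ww' (IH k.+1)).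
Qed.

Lemma agree_horner_succ cs m n w w' : cs 0 0 0 = 0 -> cs 1 0 0 = 0 ->
  w 0 0 = 0 -> w' 0 0 = 0 -> agree m w w' ->
  agree m.+1 (horner_series cs n.+2 0 w) (horner_series cs n.+2 0 w').
Proof.
move=> c0 c1 w0 w'0 ww' i j ij.
have coef00 w1 : w1 0 0 = 0 -> horner_series cs n.+1 1 w1 0 0 = 0.
  by move=> w10; rewrite /= c1 /cauchy_product !big_ord1 w10 mul0r addr0.
congr (_ + _).
exact: (agreeM_succ w0 w'0 (coef00 w w0) (coef00 w' w'0) ww'
  (agree_horner cs n.+1 1 ww') ij).
Qed.

Lemma norm_le_horner cs r M n k w : 0 <= r ->
  (forall l, norm_le (cs l) r M) -> norm_le w r 1 ->
  norm_le (horner_series cs n k w) r (n%:R * M).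
Proof.
move=> r0 csM w1; elim: n k => [|n IH] k /=.
  move=> n; rewrite mul0r; apply: sumr_le0 => i _; apply: sumr_le0 => j _.
  by rewrite /weighted_norm /cst_series if_same normr0 !mul0r.
rewrite mulrS mulrDl mul1r; apply: norm_leD => //.
rewrite -[X in norm_le _ _ X]mul1r; exact: norm_leM.
Qed.

Section FixpointSeries.
Variables (cs : nat -> nat -> nat -> C) (n : nat).
Hypotheses (cs0 : cs 0 0 0 = 0) (cs1 : cs 1 0 0 = 0).

Let step w := horner_series cs n.+2 0 w.
Let iterate m := iter m step (cst_series 0).

(** The coefficients of degree [i + j] are stationary from this iterate on. *)
Definition fixpoint_series i j := iterate (i + j).+1 i j.

Let iterate00 m : iterate m 0 0 = 0.
Proof.
elim: m => [//|m IH].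
by rewrite /iterate iterS -/(iterate m) /step /= cs0 add0r /cauchy_product !big_ord1 IH mul0r.
Qed.

Let agree_iterate_succ m : agree m (iterate m) (iterate m.+1).
Proof.
elim: m => [|m IH]; first by move=> i j.
rewrite /iterate !iterS.
exact: (agree_horner_succ n cs0 cs1 (iterate00 m) (iterate00 m.+1) IH).
Qed.

Let agree_iterate m d : agree m (iterate m) (iterate (m + d)).
Proof.
elim: d => [|d IH] i j ij; first by rewrite addn0.
rewrite IH// addnS; apply: agree_iterate_succ; exact: leq_trans (leq_addr _ _).
Qed.

Let agree_fixpoint m : agree m fixpoint_series (iterate m).
Proof.
move=> i j ij; rewrite /fixpoint_series -(subnKC ij); exact: agree_iterate.
Qed.

Lemma fixpoint_series00 : fixpoint_series 0 0 = 0.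
Proof. exact: iterate00. Qed.

Lemma fixpoint_seriesE : horner_series cs n.+2 0 fixpoint_series = fixpoint_series.
Proof.
apply/funext => i; apply/funext => j; rewrite [RHS]/fixpoint_series.
apply: (@agree_horner_succ cs (i + j)) => //; exact: iterate00.
Qed.

Lemma norm_le_fixpoint r eta : 0 <= eta ->
  (forall w, norm_le w r eta -> norm_le (horner_series cs n.+2 0 w) r eta) ->
  norm_le fixpoint_series r eta.
Proof.
move=> eta0 stab N.
have iter_le m : norm_le (iterate m) r eta.
  elim: m => [|m IH]; last exact: stab.
  move=> m; apply: le_trans eta0; apply: sumr_le0 => i _; apply: sumr_le0 => j _.
  by rewrite /weighted_norm /iterate /= /cst_series if_same normr0 !mul0r.
apply: le_trans (iter_le (N + N)%N N).
rewrite (@eq_square_sum _ _ (weighted_norm (iterate (N + N)) r))// => i j iN jN.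
rewrite /weighted_norm (@agree_fixpoint (N + N)%N i j)//.
by rewrite -addSn leq_add//; exact: ltnW.
Qed.

End FixpointSeries.

Lemma common_radius (gs : nat -> C * C -> C) n u :
    (forall l, analytic_at (gs l) u) -> (forall l, (n <= l)%N -> gs l = fun=> 0) ->
  exists cs r M, [/\ 0 < r, r <= 1, forall l, expansion (cs l) r (gs l) u &
    forall l, norm_le (cs l) r M].
Proof.
elim: n gs => [|n IH] gs gsu gs0.
  exists (fun _ => cst_series 0), 1, 0; split=> // l.
    by rewrite gs0//; exact: expansion_cst.
  move=> N; apply: sumr_le0 => i _; apply: sumr_le0 => j _.
  by rewrite /weighted_norm /cst_series if_same normr0 !mul0r.
have [|l nl|cs [r [M [r0 r1 cs' csM]]]] := IH (fun l => if l == n then fun=> 0 else gs l).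
- by move=> l; case: ifP => _; [exact: analytic_cst|exact: gsu].
- move: nl; rewrite leq_eqVlt => /orP[/eqP<-|nl]; first by rewrite eqxx.
  by rewrite gs0// if_same.
have /analytic_atP[c [r' cr']] := gsu n.
have [r'0 [M' cM'] _] := cr'.
have [s [s0 sr sr']] := exists_le_both r0 r'0.
have M0 := norm_le_ge0 (csM 0).
have M'0 := norm_le_ge0 cM'.
exists (fun l => if l == n then c else cs l), s, (M + M'); split.
- exact: s0.
- exact: le_trans sr r1.
- move=> l; have := cs' l; case: eqP => [->|_] csl.
    exact: expansion_shrink s0 sr' cr'.
  exact: expansion_shrink s0 sr csl.
- move=> l; case: ifP => _.
    apply: (@norm_le_shrink _ r') => //; first exact: ltW.
    by apply: norm_leW cM'; rewrite lerDr.
  apply: (@norm_le_shrink _ r) => //; first exact: ltW.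
  by apply: norm_leW (csM l); rewrite lerDl.
Qed.

(** Once [gs 0] and [gs 1] vanish at [u], the map to be iterated preserves a
    small ball of the weighted l1 norm for a small radius, and each iteration
    fixes the coefficients of one more degree; so the stationary values of the
    coefficients form a convergent fixed point. *)
Lemma analytic_fixpoint (gs : nat -> C * C -> C) n u :
    (forall l, analytic_at (gs l) u) -> (forall l, (n <= l)%N -> gs l = fun=> 0) ->
    gs 0 u = 0 -> gs 1 u = 0 ->
  exists f, [/\ analytic_at f u, f u = 0 &
    \forall v \near u, f v = horner_fun gs n.+2 0 (f v) v].
Proof.
move=> gsu gsn gs0 gs1; have [cs [r [M [r0 r1 csgs csM]]]] := common_radius gsu gsn.
have cs0 : cs 0 0 0 = 0 by rewrite -(expansion_coef00 (csgs 0)).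
have cs1 : cs 1 0 0 = 0 by rewrite -(expansion_coef00 (csgs 1)).
have M0 : 0 <= M := norm_le_ge0 (csM 0).
have nM0 : 0 <= n%:R * M by rewrite mulr_ge0.
(* the radius [eta] of the ball absorbs the terms of degree at least two in the
   unknown, the ratio [t] of the radii those of degree zero and one *)
pose eta : C := (4 * (n%:R * M + 1))^-1.
have eta0 : 0 < eta by rewrite invr_gt0 mulr_gt0// ltr_wpDl.
have eta1 : eta <= 4^-1.
  by rewrite lef_pV2 ?posrE ?mulr_gt0 ?ltr_wpDl// ler_peMr// lerDr.
have etanM : eta * (n%:R * M) <= 4^-1.
  rewrite /eta invfM -mulrA ler_piMr ?invr_ge0// mulrC ler_pdivrMr ?ltr_wpDl//.
  by rewrite mul1r lerDl.
pose t : C := eta / (4 * (M + 1)).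
have t0 : 0 < t by rewrite divr_gt0// mulr_gt0// ltr_wpDl.
have tM : t * M <= eta / 4.
  rewrite /t invfM mulrA -[leLHS]mulrA ler_piMr ?divr_ge0 ?(ltW eta0)//.
  by rewrite mulrC ler_pdivrMr ?ltr_wpDl// mul1r lerDl.
have eta_le1 : eta <= 1 by apply: le_trans eta1 _; rewrite invf_le1 ?ler1n.
have t1 : t <= 1.
  apply: le_trans eta_le1; rewrite /t ler_pdivrMr ?mulr_gt0 ?ltr_wpDl//.
  by rewrite ler_peMr ?(ltW eta0)// mulr_ege1 ?ler1n// lerDr.
have s0 : 0 < t * r by rewrite mulr_gt0.
have sr : t * r <= r by rewrite ler_piMl// ltW.
have s1 : t * r <= 1 by exact: le_trans sr r1.
have csgs' l : expansion (cs l) (t * r) (gs l) u by exact: expansion_shrink (csgs l).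
have csM' l : norm_le (cs l) (t * r) M by apply: norm_le_shrink (csM l) => //; exact: ltW.
have stab w : norm_le w (t * r) eta ->
    norm_le (horner_series cs n.+2 0 w) (t * r) eta.
  move=> wle; have r0' := ltW r0; have s0' := ltW s0.
  have small c : c 0 0 = 0 -> norm_le c r M -> norm_le c (t * r) (eta / 4).
    by move=> c0 cM; apply: norm_leW tM _; apply: norm_le_scale => //; exact: ltW.
  have wH := norm_leM s0' wle (norm_le_horner n 2 s0' csM' (norm_leW eta_le1 wle)).
  have := norm_leD s0' (small _ cs0 (csM 0))
    (norm_leM s0' wle (norm_leD s0' (small _ cs1 (csM 1)) wH)).
  apply: norm_leW.
  apply: le_trans (_ : eta / 4 + eta * (4^-1 + 4^-1) <= _).
    rewrite lerD2l ler_pM2l// lerD//; apply: le_trans eta1.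
    by rewrite ler_pdivrMr// ler_peMr ?(ltW eta0)// ler1n.
  rewrite -mulrDr ler_piMr ?(ltW eta0)//.
  rewrite (_ : _ + _ = 3 / 4); last by field.
  by rewrite ler_pdivrMr// mul1r ler_nat.
have wle := norm_le_fixpoint cs0 cs1 (ltW eta0) stab.
set w := fixpoint_series cs n in wle.
pose f v : C := limn (square_sum (series_term w (v.1 - u.1) (v.2 - u.2))).
have wf : expansion w (t * r) f u.
  split; [exact: s0|by exists eta|].
  move=> h k hs ks; rewrite /f /= ![_ + _ - _]addrAC !subrr !add0r.
  have [l wl] := series_cvg (ltW hs) (ltW ks) wle.
  by rewrite (cvg_lim (@norm_hausdorff _ C) wl).
have wf' := expansion_horner n.+2 0 s0 s1 csgs' wf.
rewrite fixpoint_seriesE// -/w in wf'.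
exists f; split.
- by apply/analytic_atP; exists w, (t * r).
- by rewrite (expansion_coef00 wf) /w fixpoint_series00.
- apply/nbhs_polydisc; exists (t * r); first exact: s0.
  move=> h k hs ks; have [_ _ /(_ h k hs ks) c1] := wf.
  have [_ _ /(_ h k hs ks) c2] := wf'.
  have hC := @norm_hausdorff _ C.
  exact: etrans (esym (cvg_lim hC c1)) (cvg_lim hC c2).
Qed.

End ImplicitFunction.

(** * Analytic roots and inverses *)

Section AnalyticRoots.
Variable R : realType.
Local Notation C := (Cplx R).
Implicit Types (f : C * C -> C) (u v : C * C).

Lemma analytic_horner (Q : C * C -> {poly C}) n u (z : C) :
  (forall v, (size (Q v) <= n)%N) -> (forall k, analytic_at (fun v => (Q v)`_k) u) ->
  analytic_at (fun v => (Q v).[z]) u.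
Proof.
move=> Qn Qu.
rewrite (_ : (fun v => _) = fun v => \sum_(i < n) (Q v)`_i * z ^+ i).
  apply: analytic_sum => i _.
  by apply: analyticM; [exact: Qu|exact: analytic_cst].
by apply/funext => v; exact: horner_coef_wide.
Qed.

Lemma analytic_nderivn_horner (Q : C * C -> {poly C}) n u (z : C) l :
  (forall v, (size (Q v) <= n)%N) -> (forall k, analytic_at (fun v => (Q v)`_k) u) ->
  analytic_at (fun v => (Q v)^`N(l).[z]) u.
Proof.
move=> Qn Qu; apply: (@analytic_horner _ n) => [v|k].
  apply/leq_sizeP => j nj; rewrite coef_nderivn.
  by rewrite (leq_sizeP _ _ (Qn v)) ?mul0rn// (leq_trans nj)// leq_addl.
rewrite (_ : (fun v => _) = fun v => (Q v)`_(l + k) *+ 'C(l + k, l)).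
  by apply: analytic_mulrn; exact: Qu.
by apply/funext => v; rewrite coef_nderivn.
Qed.

(** With [c] the value of the derivative at the simple root, the Newton map
    [w - Q (z + w) / c] has a coefficient of degree one that vanishes at the
    centre, so its fixed points are covered by [analytic_fixpoint]. *)
Lemma analytic_root (Q : C * C -> {poly C}) n u (z : C) :
    (forall v, (size (Q v) <= n)%N) -> (forall k, analytic_at (fun v => (Q v)`_k) u) ->
    root (Q u) z -> (Q u)^`().[z] != 0 ->
  exists f, [/\ analytic_at f u, f u = z & \forall v \near u, root (Q v) (f v)].
Proof.
move=> Qn Qu /rootP z0; set c := _.[z] => c0.
pose gs l v : C := (l == 1)%:R - c^-1 * (Q v)^`N(l).[z].
have gsu l : analytic_at (gs l) u.
  apply: analyticB; first exact: analytic_cst.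
  apply: analyticM; first exact: analytic_cst.
  exact: analytic_nderivn_horner Qn Qu.
have gsn l : (n.+2 <= l)%N -> gs l = fun=> 0.
  move=> nl; apply/funext => v; rewrite /gs gtn_eqF ?(leq_ltn_trans _ nl)//.
  rewrite nderivn_poly0 ?horner0 ?mulr0 ?subr0//.
  by apply: leq_trans (Qn v) _; rewrite ltnW// ltnW.
have gs0 : gs 0 u = 0 by rewrite /gs nderivn0 z0 mulr0 subr0.
have gs1 : gs 1 u = 0 by rewrite /gs nderivn1 -/c mulVf// subrr.
have [f [fu f0 ff]] := analytic_fixpoint gsu gsn gs0 gs1.
exists (fun v => z + f v); split.
- by apply: analyticD; [exact: analytic_cst|exact: fu].
- by rewrite f0 addr0.
apply: filterS ff => v; rewrite horner_funE => fE; apply/rootP.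
have taylor : (Q v).[z + f v] = \sum_(i < n.+4) (Q v)^`N(i).[z] * f v ^+ i.
  apply: nderiv_taylor_wide; first exact: mulrC.
  by apply: leq_trans (Qn v) _; rewrite -addn4 leq_addr.
suff : c^-1 * (Q v).[z + f v] = 0.
  by move/eqP; rewrite mulf_eq0 invr_eq0 (negbTE c0) => /eqP.
have : \sum_(i < n.+4) (i == 1 :> nat)%:R * f v ^+ i = f v :> C.
  rewrite (bigD1 (lift ord0 ord0))//= mul1r expr1 big1 ?addr0// => i i1.
  suff -> : (i == 1 :> nat) = false by rewrite mul0r.
  by apply: contraNF i1 => /eqP i1; apply/eqP/val_inj.
rewrite taylor mulr_sumr => E.
have : f v = f v - \sum_(i < n.+4) c^-1 * ((Q v)^`N(i).[z] * f v ^+ i).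
  rewrite -{2}E -sumrB {1}fE; apply: eq_bigr => i _.
  by rewrite /gs add0n mulrBl mulrA.
by move/eqP; rewrite -subr_eq0 opprB addrCA subrr addr0 => /eqP.
Qed.

(** The inverse is the root of the linear polynomial [f v *: 'X - 1]. *)
Lemma analyticV f u : analytic_at f u -> f u != 0 -> analytic_at (fun v => (f v)^-1) u.
Proof.
move=> fu f0; pose Q v : {poly C} := f v *: 'X - 1.
have [||||g [gu _ gQ]] := @analytic_root Q 2 u (f u)^-1.
- move=> v; rewrite (leq_trans (size_polyD _ _))// geq_max size_polyN size_poly1.
  by rewrite (leq_trans (size_scale_leq _ _))// size_polyX.
- move=> k.
  rewrite (_ : (fun v => _) = fun v => f v * ('X : {poly C})`_k - (1 : {poly C})`_k).
    by apply: analyticB; [apply: analyticM; [exact: fu|]|]; exact: analytic_cst.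
  by apply/funext => v; rewrite coefB coefZ.
- by apply/rootP; rewrite !hornerE mulfV// subrr.
- by rewrite derivB derivZ derivX derivC subr0 hornerZ hornerC mulr1.
apply: analytic_near_eq gu; apply: filterS gQ => v /rootP.
rewrite !hornerE => /eqP; rewrite subr_eq0 => /eqP fg.
have fv0 : f v != 0 by apply: contra_eq_neq fg => ->; rewrite mul0r eq_sym oner_eq0.
by apply: (mulfI fv0); rewrite fg mulfV.
Qed.

End AnalyticRoots.

(** * The two Lie algebras *)

Section LieAlgebras.
Variable R : realType.
Local Notation C := (Cplx R).
Implicit Types (f g p : C * C -> C) (u v : C * C) (X Y : vfield R) (D : set (C * C)).

Lemma vf_analytic_zero D : vf_analytic_on D (fun=> 0, fun=> 0).
Proof. by split=> u _; exact: analytic_cst. Qed.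

Lemma vf_analytic_lincomb D (c : C) X Y :
  vf_analytic_on D X -> vf_analytic_on D Y -> vf_analytic_on D (vf_lincomb c X Y).
Proof.
move=> [X1 X2] [Y1 Y2]; split=> u Du.
  exact: (analyticD (analyticM (analytic_cst c u) (X1 u Du)) (Y1 u Du)).
exact: (analyticD (analyticM (analytic_cst c u) (X2 u Du)) (Y2 u Du)).
Qed.

Lemma vf_analytic_bracket D X Y :
  vf_analytic_on D X -> vf_analytic_on D Y -> vf_analytic_on D (vf_bracket X Y).
Proof.
move=> [X1 X2] [Y1 Y2]; split=> u Du.
  exact: (analyticB (analytic_vf_apply (X1 u Du) (X2 u Du) (Y1 u Du))
    (analytic_vf_apply (Y1 u Du) (Y2 u Du) (X1 u Du))).
exact: (analyticB (analytic_vf_apply (X1 u Du) (X2 u Du) (Y2 u Du))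
  (analytic_vf_apply (Y1 u Du) (Y2 u Du) (X2 u Du))).
Qed.

Lemma near_open D u (P : C * C -> Prop) :
  open D -> D u -> (forall v, D v -> P v) -> \forall v \near u, P v.
Proof. by move=> oD Du DP; apply: filterS (open_nbhs_nbhs (conj oD Du)). Qed.

Lemma vf_apply_lincomb (c : C) X Y f u :
  vf_apply (vf_lincomb c X Y) f u = c * vf_apply X f u + vf_apply Y f u.
Proof.
have lin (x1 x2 y1 y2 s t : C) :
  (c * x1 + y1) * s + (c * x2 + y2) * t = c * (x1 * s + x2 * t) + (y1 * s + y2 * t) by ring.
exact: lin.
Qed.

(** If [K] and [L] are cofactors of [X] and [Y], then [X L - Y K] is a cofactor of
    their bracket. *)
Lemma lie_algebra_Der D g : open D -> analytic_on D g -> lie_algebra (Der D g).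
Proof.
move=> oD ga; split.
- split; first exact: vf_analytic_zero.
  exists (fun=> 0) => [u _|u _]; first exact: analytic_cst.
  have zero (s t k : C) : 0 * s + 0 * t = 0 * k by ring.
  exact: zero.
- move=> c X Y [Xa [K Ka KX]] [Ya [L La LY]]; split; first exact: vf_analytic_lincomb.
  exists (fun v => c * K v + L v) => u Du.
    exact: (analyticD (analyticM (analytic_cst c u) (Ka u Du)) (La u Du)).
  by rewrite vf_apply_lincomb KX// LY// mulrDl mulrA.
- move=> X Y [Xa [K Ka KX]] [Ya [L La LY]]; split; first exact: vf_analytic_bracket.
  have [[X1 X2] [Y1 Y2]] := (Xa, Ya).
  exists (fun v => vf_apply X L v - vf_apply Y K v) => u Du.
    exact: (analyticB (analytic_vf_apply (X1 u Du) (X2 u Du) (La u Du))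
      (analytic_vf_apply (Y1 u Du) (Y2 u Du) (Ka u Du))).
  have eX : vf_apply X (vf_apply Y g) u = vf_apply X L u * g u + L u * (K u * g u).
    rewrite (vf_apply_near_eq X (near_open oD Du LY)) -(KX u Du).
    exact: (vf_applyM X (La u Du) (ga u Du)).
  have eY : vf_apply Y (vf_apply X g) u = vf_apply Y K u * g u + K u * (L u * g u).
    rewrite (vf_apply_near_eq Y (near_open oD Du KX)) -(LY u Du).
    exact: (vf_applyM Y (Ka u Du) (ga u Du)).
  apply: etrans (vf_apply_bracket (X1 u Du) (X2 u Du) (Y1 u Du) (Y2 u Du) (ga u Du)) _.
  apply: etrans (congr2 (fun a b => a - b) eX eY) _.
  have cancel (x y k l h : C) :
    x * h + l * (k * h) - (y * h + k * (l * h)) = (x - y) * h by ring.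
  exact: cancel.
Qed.

Lemma dx_vf_apply X f u : analytic_at X.1 u -> analytic_at X.2 u -> analytic_at f u ->
  dx (vf_apply X f) u =
  vf_apply X (dx f) u + (dx X.1 u * dx f u + dx X.2 u * dy f u).
Proof.
move=> X1 X2 fu; have fx := analytic_dx fu; have fy := analytic_dy fu.
apply: etrans (dxD (analyticM X1 fx) (analyticM X2 fy)) _.
apply: etrans (congr2 +%R (dxM X1 fx) (dxM X2 fy)) _.
have permute (a b c x e e' : C) : e = e' -> a + b + (c + x * e) = b + x * e' + (a + c).
  by move=> ->; ring.
exact: (permute _ _ _ _ _ _ (dx_dy fu)).
Qed.

Lemma dy_vf_apply X f u : analytic_at X.1 u -> analytic_at X.2 u -> analytic_at f u ->
  dy (vf_apply X f) u =
  vf_apply X (dy f) u + (dy X.1 u * dx f u + dy X.2 u * dy f u).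
Proof.
move=> X1 X2 fu; have fx := analytic_dx fu; have fy := analytic_dy fu.
apply: etrans (dyD (analyticM X1 fx) (analyticM X2 fy)) _.
apply: etrans (congr2 +%R (dyM X1 fx) (dyM X2 fy)) _.
have permute (a x c d e e' : C) : e = e' -> a + x * e' + (c + d) = x * e + d + (a + c).
  by move=> ->; ring.
exact: (permute _ _ _ _ _ _ (dx_dy fu)).
Qed.

(** The slope component of the first prolongation of [X], restricted to the
    surface [y' = p]. *)
Definition prolongation X p u : C :=
  dx X.2 u + (dy X.2 u - dx X.1 u) * p u - dy X.1 u * p u ^+ 2.

Lemma symmetry_conditionE X p u :
  (- X.1 u * dx p u - X.2 u * dy p u + dx X.2 u
    + (dy X.2 u - dx X.1 u) * p u - dy X.1 u * p u ^+ 2 = 0) <->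
  vf_apply X p u = prolongation X p u.
Proof.
have move_terms (x1 x2 s t b0 b1 b2 : C) :
    (- x1 * s - x2 * t + b0 + b1 - b2 = 0) <-> (x1 * s + x2 * t = b0 + b1 - b2).
  rewrite (_ : _ - b2 = (b0 + b1 - b2) - (x1 * s + x2 * t)); last by ring.
  by split=> [/eqP|->]; rewrite ?subrr// subr_eq0 => /eqP.
exact: move_terms.
Qed.

Lemma analytic_prolongation X p u : analytic_at X.1 u -> analytic_at X.2 u ->
  analytic_at p u -> analytic_at (prolongation X p) u.
Proof.
move=> X1 X2 pu.
exact: (analyticB (analyticD (analytic_dx X2)
  (analyticM (analyticB (analytic_dy X2) (analytic_dx X1)) pu))
  (analyticM (analytic_dy X1) (analyticX 2 pu))).
Qed.

Lemma vf_apply_prolongation X Y p u : analytic_at Y.1 u -> analytic_at Y.2 u ->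
    analytic_at p u ->
  vf_apply X (prolongation Y p) u =
  vf_apply X (dx Y.2) u +
  ((vf_apply X (dy Y.2) u - vf_apply X (dx Y.1) u) * p u +
   (dy Y.2 u - dx Y.1 u) * vf_apply X p u) -
  (vf_apply X (dy Y.1) u * (p u * p u) +
   dy Y.1 u * (vf_apply X p u * p u + p u * vf_apply X p u)).
Proof.
move=> Y1 Y2 pu.
have Y1x := analytic_dx Y1; have Y1y := analytic_dy Y1.
have Y2x := analytic_dx Y2; have Y2y := analytic_dy Y2.
have b1 := analyticB Y2y Y1x.
apply: etrans (vf_applyB X (analyticD Y2x (analyticM b1 pu)) (analyticM Y1y (analyticX 2 pu))) _.
apply: congr2.
  apply: etrans (vf_applyD X Y2x (analyticM b1 pu)) _; apply: congr2 => //.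
  apply: etrans (vf_applyM X b1 pu) _; apply: congr2 => //.
  by rewrite (vf_applyB X Y2y Y1x).
have pp : (fun v => p v ^+ 2) = (fun v => p v * p v) by apply/funext => v; rewrite expr2.
congr (- _).
apply: etrans (vf_applyM X Y1y (analyticX 2 pu)) _; apply: congr2; first by rewrite expr2.
by apply: congr2 => //; rewrite pp (vf_applyM X pu pu).
Qed.

(** Prolongation is a morphism of Lie algebras: this is the equality of the two
    ways to differentiate the slope along the bracket. *)
Lemma prolongation_bracket X Y p u :
    analytic_at X.1 u -> analytic_at X.2 u -> analytic_at Y.1 u -> analytic_at Y.2 u ->
    analytic_at p u ->
    vf_apply X p u = prolongation X p u -> vf_apply Y p u = prolongation Y p u ->
  vf_apply X (prolongation Y p) u - vf_apply Y (prolongation X p) u =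
  prolongation (vf_bracket X Y) p u.
Proof.
move=> X1 X2 Y1 Y2 pu Xp Yp.
have eX := vf_apply_prolongation X Y1 Y2 pu.
have eY := vf_apply_prolongation Y X1 X2 pu.
have bx1 := dxB (analytic_vf_apply X1 X2 Y1) (analytic_vf_apply Y1 Y2 X1).
have bx2 := dxB (analytic_vf_apply X1 X2 Y2) (analytic_vf_apply Y1 Y2 X2).
have by1 := dyB (analytic_vf_apply X1 X2 Y1) (analytic_vf_apply Y1 Y2 X1).
have by2 := dyB (analytic_vf_apply X1 X2 Y2) (analytic_vf_apply Y1 Y2 X2).
have {}bx1 := etrans bx1 (congr2 (fun a b => a - b)
  (dx_vf_apply X1 X2 Y1) (dx_vf_apply Y1 Y2 X1)).
have {}bx2 := etrans bx2 (congr2 (fun a b => a - b)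
  (dx_vf_apply X1 X2 Y2) (dx_vf_apply Y1 Y2 X2)).
have {}by1 := etrans by1 (congr2 (fun a b => a - b)
  (dy_vf_apply X1 X2 Y1) (dy_vf_apply Y1 Y2 X1)).
have {}by2 := etrans by2 (congr2 (fun a b => a - b)
  (dy_vf_apply X1 X2 Y2) (dy_vf_apply Y1 Y2 X2)).
apply: etrans (congr2 (fun a b => a - b) eX eY) _.
rewrite Xp Yp.
have identity (q x1x x1y x2x x2y y1x y1y y2x y2y Xy1x Xy1y Xy2x Xy2y Yx1x Yx1y Yx2x Yx2y
    bx1' bx2' by1' by2' : C) :
    bx1' = Xy1x + (x1x * y1x + x2x * y1y) - (Yx1x + (y1x * x1x + y2x * x1y)) ->
    bx2' = Xy2x + (x1x * y2x + x2x * y2y) - (Yx2x + (y1x * x2x + y2x * x2y)) ->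
    by1' = Xy1y + (x1y * y1x + x2y * y1y) - (Yx1y + (y1y * x1x + y2y * x1y)) ->
    by2' = Xy2y + (x1y * y2x + x2y * y2y) - (Yx2y + (y1y * x2x + y2y * x2y)) ->
    Xy2x + ((Xy2y - Xy1x) * q +
      (y2y - y1x) * (x2x + (x2y - x1x) * q - x1y * q ^+ 2)) -
    (Xy1y * (q * q) + y1y * ((x2x + (x2y - x1x) * q - x1y * q ^+ 2) * q +
      q * (x2x + (x2y - x1x) * q - x1y * q ^+ 2))) -
    (Yx2x + ((Yx2y - Yx1x) * q +
      (x2y - x1x) * (y2x + (y2y - y1x) * q - y1y * q ^+ 2)) -
    (Yx1y * (q * q) + x1y * ((y2x + (y2y - y1x) * q - y1y * q ^+ 2) * q +
      q * (y2x + (y2y - y1x) * q - y1y * q ^+ 2)))) =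
    bx2' + (by2' - bx1') * q - by1' * q ^+ 2.
  by move=> -> -> -> ->; ring.
exact: (identity _ _ _ _ _ _ _ _ _ _ _ _ _ _ _ _ _ _ _ _ _ bx1 bx2 by1 by2).
Qed.

Lemma prolongation_lincomb (c : C) X Y p u :
    analytic_at X.1 u -> analytic_at X.2 u -> analytic_at Y.1 u -> analytic_at Y.2 u ->
  prolongation (vf_lincomb c X Y) p u = c * prolongation X p u + prolongation Y p u.
Proof.
move=> X1 X2 Y1 Y2.
have cu := analytic_cst c u.
have dxl f g : analytic_at f u -> analytic_at g u ->
    dx (fun v => c * f v + g v) u = c * dx f u + dx g u.
  move=> fu gu; apply: etrans (dxD (analyticM cu fu) gu) _.
  by rewrite (dxM cu fu) (dx_cst c u) mul0r add0r.
have dyl f g : analytic_at f u -> analytic_at g u ->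
    dy (fun v => c * f v + g v) u = c * dy f u + dy g u.
  move=> fu gu; apply: etrans (dyD (analyticM cu fu) gu) _.
  by rewrite (dyM cu fu) (dy_cst c u) mul0r add0r.
have linear (a b d e q x2x x2y x1x x1y y2x y2y y1x y1y : C) :
    a = c * x2x + y2x -> b = c * x2y + y2y -> d = c * x1x + y1x -> e = c * x1y + y1y ->
    a + (b - d) * q - e * q ^+ 2 =
    c * (x2x + (x2y - x1x) * q - x1y * q ^+ 2) + (y2x + (y2y - y1x) * q - y1y * q ^+ 2).
  by move=> -> -> -> ->; ring.
exact: (linear _ _ _ _ _ _ _ _ _ _ _ _ _ (dxl _ _ X2 Y2) (dyl _ _ X2 Y2)
  (dxl _ _ X1 Y1) (dyl _ _ X1 Y1)).
Qed.

Lemma lie_algebra_symmetries d (a : 'I_d.+1 -> C * C -> C) D :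
  lie_algebra (symmetries a D).
Proof.
split.
- split=> [|W p _ _ u _]; first exact: vf_analytic_zero.
  apply/symmetry_conditionE.
  have zero (s t x2x x2y x1x x1y q : C) : x2x = 0 -> x2y = 0 -> x1x = 0 -> x1y = 0 ->
    0 * s + 0 * t = x2x + (x2y - x1x) * q - x1y * q ^+ 2.
    by move=> -> -> -> ->; ring.
  exact: (zero _ _ _ _ _ _ _ (dx_cst 0 u) (dy_cst 0 u) (dx_cst 0 u) (dy_cst 0 u)).
- move=> c X Y [[X1 X2] Xs] [[Y1 Y2] Ys]; split; first exact: vf_analytic_lincomb.
  move=> W p WD Wp u Wu; apply/symmetry_conditionE; have Du := WD u Wu.
  rewrite vf_apply_lincomb.
  rewrite (prolongation_lincomb c p (X1 u Du) (X2 u Du) (Y1 u Du) (Y2 u Du)).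
  by have /symmetry_conditionE -> := Xs W p WD Wp u Wu;
     have /symmetry_conditionE -> := Ys W p WD Wp u Wu.
- move=> X Y [[X1 X2] Xs] [[Y1 Y2] Ys]; split; first exact: vf_analytic_bracket.
  move=> W p WD Wp u Wu; apply/symmetry_conditionE; have Du := WD u Wu.
  have [oW _ pa _] := Wp; have pu := pa u Wu.
  have Xp v : W v -> vf_apply X p v = prolongation X p v.
    by move=> Wv; apply/symmetry_conditionE; exact: Xs Wv.
  have Yp v : W v -> vf_apply Y p v = prolongation Y p v.
    by move=> Wv; apply/symmetry_conditionE; exact: Ys Wv.
  apply: etrans (vf_apply_bracket (X1 u Du) (X2 u Du) (Y1 u Du) (Y2 u Du) pu) _.
  rewrite (vf_apply_near_eq X (near_open oW Wu Yp)) (vf_apply_near_eq Y (near_open oW Wu Xp)).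
  exact: (prolongation_bracket (X1 u Du) (X2 u Du) (Y1 u Du) (Y2 u Du) pu (Xp u Wu) (Yp u Wu)).
Qed.

End LieAlgebras.

(** * Presentation polynomial and local slopes *)

Section Presentation.
Variables (R : realType) (d : nat).
Local Notation C := (Cplx R).
Variable a : 'I_d.+1 -> C * C -> C.
Implicit Types (u v : C * C).

(** Evaluation at a point, named so that it can carry its structure of ring
    morphism. *)
Definition eval_at u (f : planeFun R) : C := f u.

Fact eval_at_zmod_morphism u : zmod_morphism (eval_at u).
Proof. by move=> f g. Qed.

Fact eval_at_monoid_morphism u : monoid_morphism (eval_at u).
Proof. by split. Qed.

HB.instance Definition _ u :=
  GRing.isZmodMorphism.Build (planeFun R) C (eval_at u) (eval_at_zmod_morphism u).
HB.instance Definition _ u :=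
  GRing.isMonoidMorphism.Build (planeFun R) C (eval_at u) (eval_at_monoid_morphism u).

Lemma presentation_atE u :
  presentation_at a u = \sum_(i < d.+1) (a i u)%:P * 'X^(d - i).
Proof.
rewrite -[LHS]/(map_poly (eval_at u) (presentation a)) rmorph_sum.
by apply: eq_bigr => i _; rewrite rmorphM /= map_polyC map_polyXn.
Qed.

Lemma coef_presentation_at u k :
  (presentation_at a u)`_k = \sum_(i < d.+1) a i u * (k == d - i)%N%:R.
Proof.
by rewrite presentation_atE coef_sum; apply: eq_bigr => i _; rewrite coefCM coefXn.
Qed.

Lemma coef_presentation_at_rev u (i : 'I_d.+1) : (presentation_at a u)`_(d - i) = a i u.
Proof.
rewrite coef_presentation_at (bigD1 i)//= eqxx mulr1 big1 ?addr0// => j ji.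
suff -> : (d - i == d - j)%N = false by rewrite mulr0.
apply: contraNF ji => /eqP E; apply/eqP/val_inj => /=.
by rewrite -[RHS](subKn (ltn_ord i : (i <= d)%N)) E subKn// -ltnS.
Qed.

Lemma size_presentation_at u : (size (presentation_at a u) <= d.+1)%N.
Proof.
apply/leq_sizeP => k dk; rewrite coef_presentation_at big1// => i _.
by rewrite gtn_eqF ?mulr0// (leq_ltn_trans (leq_subr _ _)).
Qed.

Lemma size_presentation_at_lead u : a ord0 u != 0 -> size (presentation_at a u) = d.+1.
Proof.
move=> a0; apply/eqP; rewrite eqn_leq size_presentation_at ltnNge.
apply: contra a0 => /leq_sizeP/(_ d (leqnn d)).
by rewrite -[X in _`_X]subn0 (coef_presentation_at_rev u ord0) => ->.
Qed.

Lemma analytic_coef_presentation_at u k : (forall i, analytic_at (a i) u) ->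
  analytic_at (fun v => (presentation_at a v)`_k) u.
Proof.
move=> au; rewrite (_ : (fun v => _) =
    fun v => \sum_(i < d.+1) a i v * (k == d - i)%N%:R).
  by apply: analytic_sum => i _; apply: analyticM; [exact: au|exact: analytic_cst].
by apply/funext => v; exact: coef_presentation_at.
Qed.

Lemma analytic_presentation_at u (z : C) : (forall i, analytic_at (a i) u) ->
  analytic_at (fun v => (presentation_at a v).[z]) u.
Proof.
move=> au; apply: (@analytic_horner _ _ d.+1); first exact: size_presentation_at.
by move=> k; exact: analytic_coef_presentation_at.
Qed.

Lemma analytic_deriv_presentation_at u (z : C) : (forall i, analytic_at (a i) u) ->
  analytic_at (fun v => (presentation_at a v)^`().[z]) u.
Proof.
move=> au; rewrite (_ : (fun v => _) = fun v => (presentation_at a v)^`N(1).[z]).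
  apply: (@analytic_nderivn_horner _ _ d.+1); first exact: size_presentation_at.
  by move=> k; exact: analytic_coef_presentation_at.
by apply/funext => v; rewrite nderivn1.
Qed.

Lemma presentation_nonroot u i : a i u != 0 -> exists z, (presentation_at a u).[z] != 0.
Proof.
move=> ai; have /closed_nonrootP[z] : presentation_at a u != 0.
  by apply: contra_neq ai => P0; rewrite -coef_presentation_at_rev P0 coef0.
by exists z.
Qed.

Hypothesis d_gt0 : (0 < d)%N.
Hypothesis size_P : size (presentation a) = d.+1.

Local Notation P := (presentation a).

Let coef_P k v : P`_k v = (presentation_at a v)`_k.
Proof.
by rewrite -[presentation_at a v]/(map_poly (eval_at v) P) coef_map.
Qed.

Lemma size_deriv_presentation : size P^`() = d.
Proof.
apply/eqP; rewrite eqn_leq; apply/andP; split.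
  have := @lt_size_deriv _ P; rewrite size_P ltnS; apply.
  by rewrite -size_poly_eq0 size_P.
rewrite leqNgt; apply/negP => Pd.
have : (P^`())`_d.-1 = 0 by apply: (leq_sizeP _ _ (leqnn _)); rewrite -ltnS prednK.
rewrite coef_deriv prednK// => da0.
have : lead_coef P != 0 by rewrite lead_coef_eq0 -size_poly_eq0 size_P.
case/negP; apply/eqP; rewrite /lead_coef size_P /=; apply/funext => v.
have := congr1 (fun f : planeFun R => f v) da0.
rewrite -[LHS]/(eval_at v (P`_d *+ d)) rmorphMn /= -mulr_natr => /eqP.
by rewrite mulf_eq0 pnatr_eq0 (gtn_eqF d_gt0) orbF => /eqP.
Qed.

Lemma analytic_presentation_resultant u : (forall i, analytic_at (a i) u) ->
  analytic_at (presentation_resultant a) u.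
Proof.
move=> au.
have entry i j : analytic_at (Sylvester_mx P P^`() i j) u.
  have Pk k : analytic_at (P`_k) u.
    rewrite (_ : P`_k = fun v => (presentation_at a v)`_k).
      exact: analytic_coef_presentation_at.
    by apply/funext => v; exact: coef_P.
  rewrite Sylvester_mxE; case: (fintype.split i) => k.
    rewrite (_ : _ *+ _ = fun v => P`_(j - k) v *+ (k <= j)%N).
      by apply: analytic_mulrn; exact: Pk.
    by apply/funext => v; rewrite -[LHS]/(eval_at v _) rmorphMn.
  rewrite (_ : _ *+ _ = fun v => P`_(j - k).+1 v *+ (j - k).+1 *+ (k <= j)%N).
    by apply: analytic_mulrn; apply: analytic_mulrn; exact: Pk.
  by apply/funext => v; rewrite -[LHS]/(eval_at v _) rmorphMn coef_deriv rmorphMn.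
rewrite (_ : presentation_resultant a = fun v => \sum_(s : 'S_((size P^`()).-1 + (size P).-1))
    (-1) ^+ s * \prod_i Sylvester_mx P P^`() i (s i) v).
  apply: analytic_sum => s _; apply: analyticM; first exact: analytic_cst.
  by apply: analytic_prod => i _; exact: entry.
apply/funext => v; rewrite /presentation_resultant /resultant /determinant.
rewrite -[LHS]/(eval_at v _) rmorph_sum; apply: eq_bigr => s _.
rewrite rmorphM rmorph_sign rmorph_prod; congr (_ * _).
Qed.

(** The last column of the Sylvester matrix contains only multiples of the
    leading coefficient. *)
Lemma lead_neq0_of_resultant u : presentation_resultant a u != 0 -> a ord0 u != 0.
Proof.
apply: contra_neq => a0.
have Pk0 k : (d <= k)%N -> eval_at u P`_k = 0.
  rewrite /eval_at coef_P leq_eqVlt => /orP[/eqP<-|dk].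
    by rewrite -[X in _`_X]subn0 (coef_presentation_at_rev u ord0).
  exact: (leq_sizeP _ _ (size_presentation_at u)).
rewrite /presentation_resultant /resultant -[LHS]/(eval_at u _) -det_map_mx.
have szE : ((size P^`()).-1 + (size P).-1 = (d.-1 + d.-1).+1)%N.
  by rewrite size_deriv_presentation size_P /= -addnS prednK.
have lastcol : ((d.-1 + d.-1) < (size P^`()).-1 + (size P).-1)%N by rewrite szE.
rewrite (expand_det_col _ (Ordinal lastcol)) big1// => i _.
suff -> : map_mx (eval_at u) (Sylvester_mx P P^`()) i (Ordinal lastcol) = 0.
  by rewrite mul0r.
rewrite mxE Sylvester_mxE; case: (fintype.split i) => k /=.
  have kd : (k < d.-1)%N by rewrite -{2}size_deriv_presentation.
  rewrite rmorphMn /= Pk0 ?mul0rn// leq_subRL.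
    by rewrite -{2}(prednK d_gt0) addnS -addSn leq_add2r.
  exact: leq_trans (ltnW kd) (leq_addr _ _).
have kd : (k < d)%N by have := ltn_ord k; rewrite [X in (_ < X.-1)%N]size_P.
have P'k0 m : (d <= m.+1)%N -> eval_at u (P^`())`_m = 0.
  by move=> dm; rewrite coef_deriv rmorphMn /= Pk0 ?mul0rn.
have kd' : (k <= d.-1)%N by rewrite -ltnS prednK.
rewrite rmorphMn /= [X in X *+ _]P'k0 ?mul0rn//.
rewrite -[X in (X <= _)%N](prednK d_gt0) ltnS leq_subRL; first by rewrite leq_add2r.
exact: leq_trans kd' (leq_addr _ _).
Qed.

(** Where the leading coefficient does not vanish, evaluation preserves the
    degrees, hence the shape of the Sylvester matrix. *)
Lemma presentation_resultantE u : a ord0 u != 0 ->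
  presentation_resultant a u = resultant (presentation_at a u) (presentation_at a u)^`().
Proof.
move=> a0.
have P0 : eval_at u (lead_coef P) != 0.
  rewrite lead_coefE size_P /= /eval_at coef_P -[X in _`_X]subn0.
  by rewrite (coef_presentation_at_rev u ord0).
have P'0 : eval_at u (lead_coef P^`()) != 0.
  rewrite lead_coefE size_deriv_presentation coef_deriv prednK// rmorphMn /=.
  rewrite /eval_at coef_P -[X in _`_X]subn0 (coef_presentation_at_rev u ord0).
  by rewrite -mulr_natr mulf_neq0// pnatr_eq0 -lt0n.
rewrite /presentation_resultant -[LHS]/(eval_at u _).
rewrite -[presentation_at a u]/(map_poly (eval_at u) P) deriv_map.
rewrite /resultant /Sylvester_mx !size_map_poly_id0// -det_map_mx /= map_col_mx.
congr (\det (col_mx _ _));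
  apply: map_lin1_mx => v; apply/rowP=> j; rewrite !mxE /= -(coef_map (eval_at u));
  by rewrite (rmorphM (map_poly (eval_at u))) /= (map_rVpoly (eval_at u)).
Qed.

(** Outside the singular locus the roots are simple, hence extend to analytic
    slopes, which stay distinct near the base point and so factor [P_F]. *)
Lemma local_slopes (U : set (C * C)) u : open U -> (forall i, analytic_on U (a i)) ->
    U u -> presentation_resultant a u != 0 ->
  exists (W : set (C * C)) (p : 'I_d -> C * C -> C),
  [/\ W u, W `<=` U, forall i, web_slope a W (p i) &
      forall v, W v -> a ord0 v != 0 /\
        presentation_at a v = (a ord0 v)%:P * \prod_(i < d) ('X - (p i v)%:P)].
Proof.
move=> oU aU Uu res0.
have au i : analytic_at (a i) u := aU i u Uu.
have a0 := lead_neq0_of_resultant res0.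
have size_Pu := size_presentation_at_lead a0.
have coprime : coprimep (presentation_at a u) (presentation_at a u)^`().
  move: res0; rewrite presentation_resultantE// resultant_eq0 -leqNgt.
  rewrite leq_eqVlt ltnS leqn0 size_poly_eq0 gcdp_eq0 => /orP[//|/andP[/eqP P0 _]].
  by move: size_Pu; rewrite P0 size_poly0.
have [r Pr] := closed_field_poly_normal (presentation_at a u).
have lead0 : lead_coef (presentation_at a u) != 0.
  by rewrite lead_coef_eq0 -size_poly_eq0 size_Pu.
have size_r : size r = d.
  by apply: succn_inj; rewrite -size_Pu Pr size_scale// size_prod_XsubC.
have uniq_r : uniq r.
  rewrite -separable_prod_XsubC -(eqp_separable (eqp_scale _ lead0)) -Pr.
  by rewrite separable_poly.unlock.
have root_r i : (i < d)%N -> root (presentation_at a u) r`_i.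
  by move=> id; rewrite Pr rootZ// root_prod_XsubC mem_nth// size_r.
have slopes (i : 'I_d) : exists f, [/\ analytic_at f u, f u = r`_i &
    \forall v \near u, root (presentation_at a v) (f v)].
  apply: (@analytic_root _ _ d.+1); first exact: size_presentation_at.
  - by move=> k; exact: analytic_coef_presentation_at.
  - exact: root_r.
  - exact: coprimep_root coprime (root_r i (ltn_ord i)).
have [p pP] := choice slopes.
pose G v := [/\ U v, presentation_resultant a v != 0, a ord0 v != 0,
  forall i, analytic_at (p i) v /\ root (presentation_at a v) (p i v) &
  forall i j, i != j -> p i v != p j v].
have neq_near f g : analytic_at f u -> analytic_at g u -> f u != g u ->
    \forall v \near u, f v != g v.
  move=> fu gu fg; rewrite -subr_eq0 in fg.
  have fgc := analytic_continuous (analyticB fu gu).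
  have : \forall v \near u, f v - g v != 0.
    exact: (cvgr_neq0 _ fgc fg).
  by apply: filterS => v; rewrite subr_eq0.
have nearG : \forall v \near u, G v.
  have nearU : \forall v \near u, U v := open_nbhs_nbhs (conj oU Uu).
  have near_a0 := neq_near _ _ (au ord0) (analytic_cst 0 u) a0.
  have near_res := neq_near _ _ (analytic_presentation_resultant au) (analytic_cst 0 u) res0.
  have near_p i : \forall v \near u, analytic_at (p i) v /\ root (presentation_at a v) (p i v).
    by have [pu _ rp] := pP i; exact: filterI (analytic_near pu) rp.
  have near_pij (ij : 'I_d * 'I_d) :
      \forall v \near u, ij.1 != ij.2 -> p ij.1 v != p ij.2 v.
    case: ij => i j; have [-> /=|ij] := eqVneq i j.
      by apply: filterS nearU => v _; rewrite eqxx.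
    have [[pi pi0 _] [pj pj0 _]] := (pP i, pP j).
    have pij0 : p i u != p j u by rewrite pi0 pj0 nth_uniq ?size_r.
    by apply: filterS (neq_near _ _ pi pj pij0) => v.
  have all_p := filter_forall (nbhs_filter u) near_p.
  have all_pij := filter_forall (nbhs_filter u) near_pij.
  near=> v; split.
  - by near: v; exact: nearU.
  - by near: v; exact: near_res.
  - by near: v; exact: near_a0.
  - by near: v; exact: all_p.
  - suff pij : forall ij : 'I_d * 'I_d, ij.1 != ij.2 -> p ij.1 v != p ij.2 v.
      by move=> i j; exact: (pij (i, j)).
    by near: v; exact: all_pij.
exists G^°, p; split.
- exact: nearG.
- by move=> v /interior_subset[].
- move=> i; split; first exact: open_interior.
  + by move=> v /interior_subset[].
  + by move=> v /interior_subset[_ _ _ /(_ i)[]].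
  + by move=> v /interior_subset[_ _ _ /(_ i)[]].
- move=> v /interior_subset[_ _ av rp pij]; split=> //.
  have size_Pv := size_presentation_at_lead av.
  have lc : lead_coef (presentation_at a v) = a ord0 v.
    rewrite lead_coefE size_Pv /= -[X in _`_X]subn0.
    exact: (coef_presentation_at_rev v ord0).
  rewrite mul_polyC -lc.
  have := @all_roots_prod_XsubC _ (presentation_at a v) [seq p i v | i <- enum 'I_d].
  rewrite size_map size_enum_ord big_map big_enum /=; apply.
  + exact: size_Pv.
  + by apply/allP => _ /mapP[i _ ->]; have [] := rp i.
  + rewrite uniq_rootsE map_inj_uniq ?enum_uniq// => i j.
    by apply: contra_eq => /pij.
Unshelve. all: by end_near.
Qed.

End Presentation.

(** * Action on the presentation polynomial and on the discriminant *)

Section InfinitesimalFlow.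
Variable R : realType.
Local Notation C := (Cplx R).
Implicit Types (f g : C * C -> C) (u v : C * C) (X : vfield R).

(** The conditions making [f] a Darboux germ at [u] with cofactor value [k]. *)
Definition darboux X u f (k : C) : Prop :=
  analytic_at f u /\ vf_apply X f u = k * f u.

Lemma darboux_cst X u (c : C) : darboux X u (fun=> c) 0.
Proof. by split; [exact: analytic_cst|rewrite vf_apply_cst mul0r]. Qed.

Lemma darbouxM X u f g (k l : C) : darboux X u f k -> darboux X u g l ->
  darboux X u (fun v => f v * g v) (k + l).
Proof.
move=> [fu fk] [gu gl]; split; first exact: analyticM.
by rewrite (vf_applyM X fu gu) fk gl; move: (f u) (g u) => s t; ring.
Qed.

Lemma darbouxX X u f (k : C) n : darboux X u f k ->
  darboux X u (fun v => f v ^+ n) (n%:R * k).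
Proof.
move=> fk; elim: n => [|n IH].
  by rewrite mul0r; exact: (darboux_cst X u 1).
have -> : (fun v => f v ^+ n.+1) = (fun v => f v * f v ^+ n).
  by apply/funext => v; rewrite exprS.
by rewrite mulrS mulrDl mul1r; exact: darbouxM.
Qed.

Lemma darboux_prod X u (I : Type) (s : seq I) (P : pred I) (F : I -> C * C -> C)
    (k : I -> C) :
  (forall i, P i -> darboux X u (F i) (k i)) ->
  darboux X u (fun v => \prod_(i <- s | P i) F i v) (\sum_(i <- s | P i) k i).
Proof.
move=> Fk; elim: s => [|i s IH].
  rewrite big_nil (_ : (fun v => _) = fun=> 1); first exact: darboux_cst.
  by apply/funext => v; rewrite big_nil.
rewrite big_cons; case Pi : (P i).
  rewrite (_ : (fun v => _) = fun v => F i v * \prod_(i <- s | P i) F i v).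
    by apply: darbouxM; [exact: Fk|exact: IH].
  by apply/funext => v; rewrite big_cons Pi.
rewrite (_ : (fun v => _) = fun v => \prod_(i <- s | P i) F i v); first exact: IH.
by apply/funext => v; rewrite big_cons Pi.
Qed.

Section Slopes.
Variables (X : vfield R) (u : C * C) (I : Type) (p : I -> C * C -> C) (b0 b1 b2 : C).
Hypothesis p_analytic : forall i, analytic_at (p i) u.
Hypothesis p_flow : forall i, vf_apply X (p i) u = b0 + b1 * p i u + b2 * p i u ^+ 2.

Lemma darboux_slopeB i j :
  darboux X u (fun v => p i v - p j v) (b1 + b2 * (p i u + p j u)).
Proof.
split; first exact: analyticB.
rewrite (vf_applyB X (p_analytic i) (p_analytic j)) !p_flow.
by move: (p i u) (p j u) => s t; ring.
Qed.

(** Moving the roots along [b0 + b1 z + b2 z ^ 2] moves the polynomial by minus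
    that field, up to a multiple of the polynomial. *)
Lemma vf_apply_prod_subr (s : seq I) (z : C) :
  vf_apply X (fun v => \prod_(i <- s) (z - p i v)) u =
  - (b0 + b1 * z + b2 * z ^+ 2) * (\prod_(i <- s) ('X - (p i u)%:P))^`().[z] +
  (\sum_(i <- s) (b1 + b2 * (z + p i u))) * \prod_(i <- s) (z - p i u).
Proof.
elim: s => [|i s IH].
  rewrite (_ : (fun v => _) = fun=> 1); last by apply/funext => v; rewrite big_nil.
  by rewrite vf_apply_cst !big_nil derivC horner0 mulr0 mul0r addr0.
rewrite (_ : (fun v => _) = fun v => (z - p i v) * \prod_(i <- s) (z - p i v)); last first.
  by apply/funext => v; rewrite big_cons.
have zp : analytic_at (fun v => z - p i v) u.
  exact: (analyticB (analytic_cst z u) (p_analytic i)).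
have rest : analytic_at (fun v => \prod_(i <- s) (z - p i v)) u.
  by apply: analytic_prod => j _; exact: (analyticB (analytic_cst z u) (p_analytic j)).
apply: etrans (vf_applyM X zp rest) _.
rewrite IH (vf_applyB X (analytic_cst z u) (p_analytic i)) vf_apply_cst p_flow !big_cons.
have hornerQ : (\prod_(j <- s) ('X - (p j u)%:P)).[z] = \prod_(j <- s) (z - p j u).
  by rewrite horner_prod; apply: eq_bigr => j _; rewrite hornerXsubC.
rewrite derivM derivXsubC mul1r hornerD hornerM hornerXsubC hornerQ.
have identity (w q q' t : C) :
    (0 - (b0 + b1 * w + b2 * w ^+ 2)) * q + (z - w) *
      (- (b0 + b1 * z + b2 * z ^+ 2) * q' + t * q) =
    - (b0 + b1 * z + b2 * z ^+ 2) * (q + (z - w) * q') +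
      (b1 + b2 * (z + w) + t) * ((z - w) * q) by ring.
exact: identity.
Qed.

End Slopes.

(** Each index belongs to [d.-1] pairs. *)
Lemma sum_pairs (V : nmodType) d (g : 'I_d -> V) :
  \sum_(i < d) \sum_(j < d | (i < j)%N) (g i + g j) = (\sum_(i < d) g i) *+ d.-1.
Proof.
under eq_bigr do rewrite big_split/=.
rewrite big_split /= [X in _ + X](exchange_big_dep predT)//= -big_split /= -sumrMnl.
apply: eq_bigr => i _; rewrite -[in RHS](card_ord d) -(cardC1 i) -sumr_const.
rewrite [RHS](bigID (fun j : 'I_d => (i < j)%N)) /=; congr (_ + _); apply: eq_bigl => j.
  by rewrite inE; case: eqVneq => [->|]; rewrite ?ltnn.
rewrite inE -leqNgt ltn_neqAle; congr (_ && _).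
Qed.

Variables (d : nat) (a : 'I_d.+1 -> C * C -> C).

(** The action on [P_F (z)] of the prolonged field, corrected by the multiple of
    [P_F] that makes it a polynomial of degree at most [d] in [z]. *)
Definition prolonged_action X (z : C) v : C :=
  vf_apply X (fun w => (presentation_at a w).[z]) v +
  prolongation X (fun=> z) v * (presentation_at a v)^`().[z] -
  d%:R * (dy X.2 v - dx X.1 v - dy X.1 v * z) * (presentation_at a v).[z].

Hypothesis d_gt0 : (0 < d)%N.
Hypothesis size_P : size (presentation a) = d.+1.
Variable U : set (C * C).
Hypothesis openU : open U.
Hypothesis a_analytic : forall i, analytic_on U (a i).
Variable Delta : C * C -> C.
Hypothesis Delta_discriminant : is_discriminant a U Delta.

(** Near a regular point [P_F] and [Delta] are products over the slopes [p i], and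
    a symmetry moves each slope along the same field [b0 + b1 z + b2 z ^ 2]. With
    [mu = X a_0 / a_0 + b2 * (sum of the p i)], the first identity comes from
    [vf_apply_prod_subr] and the second one from the cofactors
    [b1 + b2 * (p i + p j)] of the differences of slopes. *)
Lemma regular_cofactor X u : symmetries a (equation_domain a U) X ->
    U u -> presentation_resultant a u != 0 ->
  exists mu : C, (forall z, prolonged_action X z u = mu * (presentation_at a u).[z]) /\
    vf_apply X Delta u =
    ((2 * d - 2)%:R * mu + (d * d.-1)%:R * (dy X.2 u - dx X.1 u)) * Delta u.
Proof.
move=> [[X1 X2] Xs] Uu res0.
have [W [p [Wu WU slope fact]]] := local_slopes d_gt0 size_P openU a_analytic Uu res0.
have WD : W `<=` equation_domain a U.
  by move=> v Wv; split; [exact: WU|exists ord0; have [] := fact v Wv].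
have oW : open W by have [] := slope (Ordinal d_gt0).
have pu i : analytic_at (p i) u by have [_ _ + _] := slope i; exact.
have [a0 Pu] := fact u Wu.
pose b0 := dx X.2 u; pose b1 := dy X.2 u - dx X.1 u; pose b2 := - dy X.1 u.
have flow i : vf_apply X (p i) u = b0 + b1 * p i u + b2 * p i u ^+ 2.
  rewrite [RHS](_ : _ = prolongation X (p i) u); last by rewrite /prolongation -mulNr.
  by apply/symmetry_conditionE; exact: (Xs W (p i) WD (slope i) u Wu).
pose e1 := \sum_(i < d) p i u.
pose k0 := vf_apply X (a ord0) u / a ord0 u.
have a0u : analytic_at (a ord0) u := a_analytic ord0 Uu.
have a0k : darboux X u (a ord0) k0 by split; rewrite // divfK.
exists (k0 + b2 * e1); split=> [z|].
  have Pz v : W v -> (presentation_at a v).[z] = a ord0 v * \prod_(i < d) (z - p i v).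
    move=> Wv; have [_ ->] := fact v Wv.
    by rewrite hornerM hornerC horner_prod; under eq_bigr do rewrite hornerXsubC.
  have prodz : analytic_at (fun v => \prod_(i < d) (z - p i v)) u.
    by apply: analytic_prod => j _; exact: (analyticB (analytic_cst z u) (pu j)).
  have BE : prolongation X (fun=> z) u = b0 + b1 * z + b2 * z ^+ 2.
    by rewrite /prolongation -mulNr.
  have XP : vf_apply X (fun w => (presentation_at a w).[z]) u =
      k0 * a ord0 u * \prod_(i < d) (z - p i u) + a ord0 u *
      (- prolongation X (fun=> z) u * (\prod_(i < d) ('X - (p i u)%:P))^`().[z] +
       (\sum_(i < d) (b1 + b2 * (z + p i u))) * \prod_(i < d) (z - p i u)).
    rewrite (vf_apply_near_eq X (near_open oW Wu Pz)) BE -(vf_apply_prod_subr pu flow) -a0k.2.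
    exact: (vf_applyM X a0u prodz).
  have P'z : (presentation_at a u)^`().[z] =
      a ord0 u * (\prod_(i < d) ('X - (p i u)%:P))^`().[z].
    by rewrite Pu derivM derivC mul0r add0r hornerM hornerC.
  have sumE : \sum_(i < d) (b1 + b2 * (z + p i u)) = d%:R * b1 + d%:R * (b2 * z) + b2 * e1.
    rewrite (eq_bigr (fun i => (b1 + b2 * z) + b2 * p i u)) => [|i _]; last first.
      by rewrite mulrDr addrA.
    by rewrite big_split /= sumr_const card_ord -mulr_sumr mulrnDl !mulr_natl.
  have slopeE : dy X.2 u - dx X.1 u - dy X.1 u * z = b1 + b2 * z by rewrite -mulNr.
  have combine (D B P' P s w q c A n k e B1 B2 : C) :
      D = k * A * w + A * (- B * q + s * w) -> P' = A * q ->
      s = n * B1 + n * (B2 * z) + B2 * e -> c = B1 + B2 * z -> P = A * w ->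
      D + B * P' - n * c * P = (k + B2 * e) * P.
    by move=> -> -> -> -> ->; ring.
  exact: (combine _ _ _ _ _ _ _ _ _ _ _ _ _ _ XP P'z sumE slopeE (Pz u Wu)).
have DeltaW v : W v -> Delta v = a ord0 v ^+ (2 * d - 2) *
    \prod_(i < d) \prod_(j < d | (i < j)%N) (p i v - p j v) ^+ 2.
  by move=> Wv; have [a0v Pv] := fact v Wv; apply: Delta_discriminant.2 => //; exact: WU.
have dDelta := darbouxM (darbouxX (2 * d - 2) a0k)
  (darboux_prod (index_enum 'I_d) (P := predT) (fun i _ =>
   darboux_prod (index_enum 'I_d) (P := fun j => (i < j)%N) (fun j _ =>
   darbouxX 2 (darboux_slopeB pu flow i j)))).
rewrite (vf_apply_near_eq X (near_open oW Wu DeltaW)) (DeltaW u Wu) dDelta.2; congr (_ * _).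
have -> : \sum_(i < d) \sum_(j < d | (i < j)%N) (2%:R * (b1 + b2 * (p i u + p j u))) =
   (\sum_(i < d) (b1 + 2 * b2 * p i u)) *+ d.-1.
  rewrite -sum_pairs; apply: eq_bigr => i _; apply: eq_bigr => j _.
  have split_pair (s t B1 B2 : C) :
    2%:R * (B1 + B2 * (s + t)) = B1 + 2 * B2 * s + (B1 + 2 * B2 * t) by ring.
  exact: split_pair.
rewrite big_split /= sumr_const card_ord -mulr_sumr -/e1 -/b1.
have -> : (2 * d - 2 = 2 * d.-1)%N by rewrite -subn1 mulnBr muln1.
rewrite -[X in _ + X]mulr_natl -[b1 *+ d]mulr_natl !natrM.
have combine (k B1 B2 e n m : C) :
  2%:R * m * k + m * (n * B1 + 2 * B2 * e) = 2%:R * m * (k + B2 * e) + n * m * B1 by ring.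
exact: combine.
Qed.

End InfinitesimalFlow.

(** * The cofactor across the singular locus *)

Section Cofactor.
Variables (R : realType) (d : nat).
Local Notation C := (Cplx R).
Variables (a : 'I_d.+1 -> C * C -> C) (U : set (C * C)).
Implicit Types (f : C * C -> C) (u v : C * C) (X : vfield R).
Hypothesis openU : open U.
Hypothesis a_analytic : forall i, analytic_on U (a i).

Local Notation D := (equation_domain a U).

Lemma near_neq0 f u : analytic_at f u -> f u != 0 -> \forall v \near u, f v != 0.
Proof. by move=> fu; exact: (cvgr_neq0 _ (analytic_continuous fu)). Qed.

Lemma open_equation_domain : open D.
Proof.
rewrite openE => u [Uu [i ai]].
apply: filterS2 (open_nbhs_nbhs (conj openU Uu)) (near_neq0 (a_analytic i Uu) ai).
by move=> v Uv av; split=> //; exists i.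
Qed.

Hypothesis resultant_neq0 : forall V : set (C * C),
  open V -> V `<=` U -> V !=set0 -> exists2 u, V u & presentation_resultant a u != 0.

(** The regular points are dense and analytic functions are continuous. *)
Lemma vanish_of_regular f : analytic_on D f ->
  (forall u, U u -> presentation_resultant a u != 0 -> f u = 0) ->
  forall u, D u -> f u = 0.
Proof.
move=> fa f0 u Du; apply/eqP/negP => /negP fu.
pose G v := D v /\ f v != 0.
have nearG : nbhs u G.
  exact: filterI (open_nbhs_nbhs (conj open_equation_domain Du)) (near_neq0 (fa u Du) fu).
have [||v /interior_subset[[Uv _] /eqP fv]] := resultant_neq0 (@open_interior _ G).
- by move=> v /interior_subset[[]].
- by exists u.
- by move=> /(f0 v Uv).
Qed.

Hypothesis d_gt0 : (0 < d)%N.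
Hypothesis size_P : size (presentation a) = d.+1.
Variable Delta : C * C -> C.
Hypothesis Delta_discriminant : is_discriminant a U Delta.

(** At a regular point the cofactor is an affine function of the number [mu] of
    [regular_cofactor], and [mu] is the quotient of [prolonged_action] by
    [P_F (z)] for each [z] that is not a root. By density these quotients agree
    for all [z] wherever they are defined. Hence they define [mu] wherever some
    coefficient of [P_F] is nonzero, also where [a_0] or [Delta] vanishes. *)
Lemma symmetries_sub_Der : symmetries a D `<=` Der D Delta.
Proof.
move=> X Xs; have [[X1 X2] _] := Xs; split; first by [].
have aD u : D u -> forall i, analytic_at (a i) u by case=> Uu _ i; exact: a_analytic.
have DeltaD u : D u -> analytic_at Delta u by case=> Uu _; exact: Delta_discriminant.1.
pose N z v := prolonged_action a X z v.
pose P z v := (presentation_at a v).[z].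
pose b v := dy X.2 v - dx X.1 v.
have Pa z u : D u -> analytic_at (P z) u.
  by move=> Du; apply: analytic_presentation_at; exact: aD.
have ba u : D u -> analytic_at b u.
  by move=> Du; exact: (analyticB (analytic_dy (X2 u Du)) (analytic_dx (X1 u Du))).
have Na z u : D u -> analytic_at (N z) u.
  move=> Du; have [X1u X2u] := (X1 u Du, X2 u Du).
  exact: (analyticB
    (analyticD (analytic_vf_apply X1u X2u (Pa z u Du))
       (analyticM (analytic_prolongation X1u X2u (analytic_cst z u))
          (analytic_deriv_presentation_at z (aD u Du))))
    (analyticM (analyticM (analytic_cst d%:R u)
        (analyticB (ba u Du) (analyticM (analytic_dy X1u) (analytic_cst z u))))
      (Pa z u Du))).
have regular u (Uu : U u) (res0 : presentation_resultant a u != 0) :=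
  regular_cofactor d_gt0 size_P openU a_analytic Delta_discriminant Xs Uu res0.
have cross z z' u : D u -> N z u * P z' u - N z' u * P z u = 0.
  move: u; apply: (@vanish_of_regular (fun u => N z u * P z' u - N z' u * P z u)) =>
    [u Du|u Uu res0].
    exact: (analyticB (analyticM (Na z u Du) (Pa z' u Du))
      (analyticM (Na z' u Du) (Pa z u Du))).
  have [mu [NE _]] := regular u Uu res0.
  by rewrite /N !NE /P mulrAC subrr.
pose c1 : C := (2 * d - 2)%:R; pose c2 : C := (d * d.-1)%:R.
have cofactor z u : D u ->
    vf_apply X Delta u * P z u - (c1 * N z u + c2 * b u * P z u) * Delta u = 0.
  move: u; apply: (@vanish_of_regular (fun u =>
    vf_apply X Delta u * P z u - (c1 * N z u + c2 * b u * P z u) * Delta u)) =>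
    [u Du|u Uu res0].
    have cst e := analytic_cst e u.
    exact: (analyticB
      (analyticM (analytic_vf_apply (X1 u Du) (X2 u Du) (DeltaD u Du)) (Pa z u Du))
      (analyticM (analyticD (analyticM (cst c1) (Na z u Du))
         (analyticM (analyticM (cst c2) (ba u Du)) (Pa z u Du))) (DeltaD u Du))).
  have [mu [NE XE]] := regular u Uu res0.
  have identity (q w m x y e : C) : x = m * w -> y = (c1 * m + c2 * e) * q ->
      y * w - (c1 * x + c2 * e * w) * q = 0 by move=> -> ->; ring.
  exact: (identity _ _ _ _ _ _ (NE z) XE).
(* 0 is the default value, taken where [P_F] vanishes identically *)
pose pick v : C := xget 0 [set z | P z v != 0].
have pickP u : D u -> P (pick u) u != 0.
  move=> [_ [i ai]]; have [z Pz] := presentation_nonroot ai.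
  exact: (xgetPex 0 (ex_intro (fun z => P z u != 0) z Pz)).
exists (fun v => c1 * (N (pick v) v * (P (pick v) v)^-1) + c2 * b v) => u Du.
  pose z := pick u.
  have local : analytic_at (fun v => c1 * (N z v * (P z v)^-1) + c2 * b v) u.
    have cst e := analytic_cst e u.
    exact: (analyticD (analyticM (cst c1)
      (analyticM (Na z u Du) (analyticV (Pa z u Du) (pickP u Du))))
      (analyticM (cst c2) (ba u Du))).
  (* near [u] the varying choice [pick v] can be replaced with the fixed [z] *)
  apply: analytic_near_eq local.
  apply: filterS2 (open_nbhs_nbhs (conj open_equation_domain Du))
    (near_neq0 (Pa z u Du) (pickP u Du)) => v Dv Pz.
  have Pv := pickP v Dv; congr (c1 * _ + _); apply/eqP.
  by rewrite eqr_div//; apply/eqP/subr0_eq; exact: cross.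
have := cofactor (pick u) u Du; have Pu := pickP u Du => /eqP.
rewrite subr_eq0 => /eqP E; apply: (mulIf Pu); rewrite E.
have identity (n w e q : C) : w != 0 ->
    (c1 * n + c2 * e * w) * q = (c1 * (n * w^-1) + c2 * e) * q * w.
  by move=> w0; field.
exact: identity.
Qed.

End Cofactor.

Theorem mainTheorem4 (R : realType) (d : nat) (d_gt0 : (0 < d)%N)
    (U : set (Cplx R * Cplx R)) (openU : open U)
    (a : 'I_d.+1 -> Cplx R * Cplx R -> Cplx R)
    (a_analytic : forall i, analytic_on U (a i))
    (deg_presentation : size (presentation a) = d.+1)
    (resultant_neq0 : forall V : set (Cplx R * Cplx R),
       open V -> V `<=` U -> V !=set0 ->
       exists2 u, V u & presentation_resultant a u != 0)
    (Delta : Cplx R * Cplx R -> Cplx R)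
    (Delta_discriminant : is_discriminant a U Delta) :
  lie_subalgebra (symmetries a (equation_domain a U))
                 (Der (equation_domain a U) Delta).
Proof.
split; first exact: lie_algebra_symmetries.
  apply: lie_algebra_Der; first exact: open_equation_domain.
  by move=> u [Uu _]; exact: Delta_discriminant.1.
exact: symmetries_sub_Der.
Qed.
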